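(* Let $0<p\le1$. Then $(s^p)^*=c^p$. More precisely, for $t=\{t_{\mathcal R}\}\in c^p$ the map which sends $s=\{s_{\mathcal R}\}$ to $\langle s,t\rangle=\sum_{\mathcal R}s_{\mathcal R}\overline{t}_{\mathcal R}$ defines a continuous linear functional on $s^p$ with operator norm $\|t\|_{(s^p)^*}\approx\|t\|_{c^p}$, and moreover, every $\ell\in(s^p)^*$ is of this form for some $t\in c^p$.
   Context: $\mathbb{H}^n=\mathbb{C}^n\times\mathbb{R}$ is the Heisenberg group with $(z,t)\circ(w,s)=(z+w,t+s+2\operatorname{Im}(z\cdot\overline w))$ and Lebesgue measure; $A\approx B$ means comparable up to constants independent of the sequences. **Dyadic rectangles.** Fix $m\ge1$ and, for each $i\in m\mathbb{Z}$, a partition of $\mathbb{H}^n$ into dyadic cubes $S_{i,q,\tau}$, $(q,\tau)\in2^i\mathbb{Z}^{2n}\times2^{2i}\mathbb{Z}$, nested across scales, projecting onto the dyadic cubes $I^i_q=q+[0,2^i)^{2n}$ of $\mathbb{C}^n$, and each containing and contained in Heisenberg balls (for $d(x,y)=\rho(x\circ y^{-1})$, $\rho(z,t)=(|z|^4+t^2)^{1/4}$) of radius comparable to $2^i$ centred at (centre of $I^i_q$, $\tau+\frac12 2^{2i}$). For $i\le l$ in $m\mathbb{Z}$ and $S_{i,q,\tau}\subset S_{l,q',\tau'}$, the vertical dyadic rectangle of width $2^i$ and height $2^{2l}$ is $\bigcup\{S_{i,q,\sigma}:S_{i,q,\sigma}\subset S_{l,q',\tau'}\}$. Fix $\kappa>0$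 small and $N\in\mathbb{N}$ large. For $j\ge k$ let $\mathsf{R}(j,k)$ be the set of vertical dyadic rectangles of width $2^{-\kappa(j+N)}$ and height $2^{-2\kappa(k+N)}$ (a scale $2^{r}$ is replaced by $2^{i}$, $i$ the largest element of $m\mathbb{Z}$ with $i\le r$), $\mathsf{Q}(j)=\mathsf{R}(j,j)$ (cubes), and $\mathsf R_+=\bigcup_j\mathsf{Q}(j)\cup\bigcup_{j>k}\mathsf{R}(j,k)$ (indexed union): all dyadic cubes and all vertical dyadic rectangles. **Sequence spaces.** $s^p$ is the collection of all sequences $s=\{s_{\mathcal R}\}_{\mathcal R\in\mathsf R_+}$ with $$\|s\|_{s^p}=\Big\|\Big\{\sum_{\mathcal R\in\mathsf R_+}|s_{\mathcal R}|^2|\mathcal R|^{-1}\chi_{\mathcal R}\Big\}^{1/2}\Big\|_{L^p(\mathbb H^n)}<\infty.$$ $c^p$ is the collection of all sequences $s=\{s_{\mathcal R}\}_{\mathcal R\in\mathsf R_+}$ with $$\|s\|_{c^p}=\sup_\Omega\Big\{\frac1{|\Omega|^{2/p-1}}\sum_{\mathcal R\in\mathsf R_+,\ \mathcal R\subset\Omega}|s_{\mathcal R}|^2\Big\}^{1/2}<\infty,$$ where $\Omega$ ranges over all open sets in $\mathbb H^n$ with finite measure. $(s^p)^*$ is the space of continuous linear functionals on $s^p$. *)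

(* Defs.v *)
From HB Require Import structures.
From mathcomp Require Import all_boot all_order all_algebra.
From mathcomp Require Import all_classical all_reals all_analysis.
From mathcomp Require Import finmap complex.
From mathcomp Require Import showcase.summability.
Set Implicit Arguments. Unset Strict Implicit. Unset Printing Implicit Defensive.
Import Order.TTheory GRing.Theory Num.Theory.
Import numFieldNormedType.Exports.
Local Open Scope classical_set_scope.
Local Open Scope ring_scope.
Local Open Scope complex_scope.

Section measurable_rV.
Context d (T : measurableType d) (n : nat).

Let coord (i : 'I_n) (v : 'rV[T]_n) : T := v ord0 i.

Let rV_set0 : g_sigma_preimage coord set0.
Proof. exact: sigma_algebra0. Qed.

Let rV_setC A : g_sigma_preimage coord A -> g_sigma_preimage coord (~` A).
Proof. exact: sigma_algebraC. Qed.

Let rV_bigcup (F : (set 'rV[T]_n)^nat) :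
  (forall i, g_sigma_preimage coord (F i)) ->
  g_sigma_preimage coord (\bigcup_i (F i)).
Proof. exact: sigma_algebra_bigcup. Qed.

HB.instance Definition _ := @isMeasurable.Build (measure_tuple_display d)
  'rV[T]_n (g_sigma_preimage coord) rV_set0 rV_setC rV_bigcup.

Lemma measurable_rV_coord (i : 'I_n) :
  measurable_fun [set: 'rV[T]_n] (fun v => v ord0 i).
Proof.
move=> _ Y mY; rewrite setTI; apply: sub_sigma_algebra => /=.
rewrite -bigcup_seq/=; exists i => /=; first by rewrite mem_index_enum.
by exists Y => //; rewrite setTI.
Qed.

Lemma measurable_fun_rVP d' (T' : measurableType d') (f : T' -> 'rV[T]_n) :
  (forall i, measurable_fun [set: T'] (fun x => f x ord0 i)) ->
  measurable_fun [set: T'] f.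
Proof.
move=> mf; apply: (@measurability _ _ _ _ _ _
  (\big[setU/set0]_(i < n) preimage_set_system setT (coord i) measurable)) => //.
move=> _ [B + <-]; rewrite -bigcup_seq/= => -[i _ [C mC <-]].
by rewrite setTI; exact: mf.
Qed.

End measurable_rV.

Section cons_rV.
Context d (T : measurableType d) (n : nat).

Definition cons_rV (p : T * 'rV[T]_n) : 'rV[T]_n.+1 :=
  \row_i (if unlift ord0 i is Some j then p.2 ord0 j else p.1).

Definition uncons_rV (v : 'rV[T]_n.+1) : T * 'rV[T]_n :=
  (v ord0 ord0, \row_j v ord0 (lift ord0 j)).

Lemma cons_rVK : cancel cons_rV uncons_rV.
Proof.
move=> [x v]; rewrite /uncons_rV /cons_rV mxE unlift_none; congr pair.
by apply/rowP => j; rewrite !mxE liftK.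
Qed.

Lemma measurable_cons_rV : measurable_fun [set: T * 'rV[T]_n] cons_rV.
Proof.
apply: measurable_fun_rVP => i; case: (unliftP ord0 i) => [j|] ->.
  rewrite (_ : (fun x => _) = (fun v : 'rV[T]_n => v ord0 j) \o snd); last first.
    by apply/funext => x; rewrite mxE liftK.
  by apply: measurableT_comp => //; exact: measurable_rV_coord.
rewrite (_ : (fun x => _) = fst)//.
by apply/funext => x; rewrite mxE unlift_none.
Qed.

Lemma measurable_uncons_rV : measurable_fun [set: 'rV[T]_n.+1] uncons_rV.
Proof.
apply: measurable_fun_pair; first exact: measurable_rV_coord.
apply: measurable_fun_rVP => i.
rewrite (_ : (fun x => _) = fun v : 'rV[T]_n.+1 => v ord0 (lift ord0 i)).
  exact: measurable_rV_coord.
by apply/funext => x; rewrite mxE.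
Qed.

End cons_rV.

Section lebesgue_rV.
Context (R : realType).

Section step.
Context (n : nat) (m : {sigma_finite_measure set 'rV[R]_n -> \bar R}).

Definition lebesgue_rV_step : set 'rV[R]_n.+1 -> \bar R :=
  pushforward (@lebesgue_measure R \x m)%E (@cons_rV _ R n).

Let step0 : lebesgue_rV_step set0 = 0%E.
Proof. by rewrite /lebesgue_rV_step /pushforward preimage_set0 measure0. Qed.

Let step_ge0 A : (0 <= lebesgue_rV_step A)%E.
Proof. by rewrite /lebesgue_rV_step /pushforward; exact: measure_ge0. Qed.

Let step_sigma_additive : semi_sigma_additive lebesgue_rV_step.
Proof.
have mc A : measurable A -> measurable (@cons_rV _ R n @^-1` A).
  by move=> mA; rewrite -[X in measurable X]setTI; exact: measurable_cons_rV.
move=> F mF tF mUF; rewrite /lebesgue_rV_step /pushforward preimage_bigcup.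
apply: measure_semi_sigma_additive => [i||]; first exact: mc.
  apply/trivIsetP => /= i j _ _ ij; rewrite -preimage_setI.
  by move/trivIsetP : tF => /(_ _ _ _ _ ij) ->//; rewrite preimage_set0.
by rewrite -preimage_bigcup; exact: mc.
Qed.

HB.instance Definition _ := isMeasure.Build _ _ _ lebesgue_rV_step
  step0 step_ge0 step_sigma_additive.

Let step_sigma_finite : sigma_finite setT lebesgue_rV_step.
Proof.
have /sigma_finiteP[F [TF ndF Foo]] := sigma_finiteT (@lebesgue_measure R).
have /sigma_finiteP[G [TG ndG Goo]] := sigma_finiteT m.
exists (fun k => @uncons_rV _ R n @^-1` (F k `*` G k)).
  rewrite -preimage_bigcup -[LHS](preimage_setT (@uncons_rV _ R n)).
  congr (_ @^-1` _); rewrite -setXTT TF TG predeqE => -[x y]; split.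
    move=> [/= [i _ Fnx] [k _ Gky]]; exists (maxn i k) => //; split.
    - by move: x Fnx; exact/subsetPset/ndF/leq_maxl.
    - by move: y Gky; exact/subsetPset/ndG/leq_maxr.
  by move=> [i _ []/= ? ?]; split; exists i.
move=> k; have [mF Fk] := Foo k; have [mG Gk] := Goo k; split.
  rewrite -[X in measurable X]setTI; apply: measurable_uncons_rV => //.
  exact: measurableX.
rewrite /lebesgue_rV_step /pushforward -comp_preimage.
rewrite (_ : _ \o _ = id).
  by rewrite /= product_measure1E// lte_mul_pinfty// ge0_fin_numE.
by apply/funext => x /=; rewrite cons_rVK.
Qed.

HB.instance Definition _ := Measure_isSigmaFinite.Build _ _ _ lebesgue_rV_step
  step_sigma_finite.

End step.

Fixpoint lebesgue_rV (n : nat) : {sigma_finite_measure set 'rV[R]_n -> \bar R} :=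
  match n with
  | 0 => \d_(0 : 'rV[R]_0)
  | n'.+1 => lebesgue_rV_step (lebesgue_rV n')
  end.

Lemma lebesgue_rV_box n (A : 'I_n -> set R) : (forall i, measurable (A i)) ->
  lebesgue_rV n [set v | forall i, A i (v ord0 i)] =
  (\prod_(i < n) lebesgue_measure (A i))%E.
Proof.
elim: n A => [|n IH] A mA.
  rewrite big_ord0 /= diracE mem_set//.
  by case.
have mB : measurable [set v : 'rV[R]_n | forall i, A (lift ord0 i) (v ord0 i)].
  rewrite [X in measurable X](_ : _ = \bigcap_(i : 'I_n)
     ((fun v : 'rV[R]_n => v ord0 i) @^-1` A (lift ord0 i))); last first.
    by apply/seteqP; split => v /= Av i; [move=> _|]; exact: Av.
  apply: fin_bigcap_measurable => // i _; rewrite -[X in measurable X]setTI.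
  exact: measurable_rV_coord.
rewrite big_ord_recl -IH // -product_measure1E//; last exact: (mA ord0).
transitivity ((@lebesgue_measure R \x lebesgue_rV n)%E
  (@cons_rV _ R n @^-1` [set v | forall i, A i (v ord0 i)])); first by [].
congr (_ _).
apply/seteqP; split => -[x v] /= Av.
  split=> /= [|i]; first by have := Av ord0; rewrite mxE unlift_none.
  by have := Av (lift ord0 i); rewrite mxE liftK.
by move=> i; rewrite mxE; have [xA vA] := Av; case: (unliftP ord0 i) => [j|] ->.
Qed.

End lebesgue_rV.

(* The point ((x, y), t) stands for (x + iy, t) in C^n x R; measurableTypeR R
   is R with its Borel sigma-algebra, so that heis R n carries both the
   product topology and the product Borel sigma-algebra. *)
Definition heis (R : realType) (n : nat) : Type :=
  ('rV[R]_n * 'rV[R]_n * measurableTypeR R)%type.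

Section heisenberg.
Context {R : realType} {n : nat}.
Implicit Types x y : heis R n.

Definition heis_measure : {measure set (heis R n) -> \bar R} :=
  ((lebesgue_rV R n \x lebesgue_rV R n) \x @lebesgue_measure R)%E.

Definition heis_z x (k : 'I_n) : R[i] := x.1.1 ord0 k +i* x.1.2 ord0 k.

Definition heis_mul x y : heis R n :=
  (x.1 + y.1,
   x.2 + y.2 + 2 * complex.Im (\sum_(k < n) heis_z x k * (heis_z y k)^*)).

Definition heis_inv x : heis R n := (- x.1, - x.2).

Definition heis_rho x : R :=
  ((\sum_(k < n) Normc.normc (heis_z x k) ^+ 2) ^+ 2 + x.2 ^+ 2) `^ (4^-1).

Definition heis_dist x y : R := heis_rho (heis_mul x (heis_inv y)).

Definition heis_ball x (r : R) : set (heis R n) := [set y | heis_dist y x < r].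

End heisenberg.

Section dyadic.
Context {R : realType} {n : nat}.

(* Dyadic points are given by integer coordinates: (a, b) encodes
   (q, tau) = (2^i a, 2^(2i) b) in 2^i Z^(2n) x 2^(2i) Z. *)
Definition dyadic_base (i : int) (a : 'rV[int]_n * 'rV[int]_n) :
    set ('rV[R]_n * 'rV[R]_n) :=
  [set z : 'rV[R]_n * 'rV[R]_n | forall k : 'I_n,
    2 ^ i * (a.1 ord0 k)%:~R <= z.1 ord0 k < 2 ^ i * ((a.1 ord0 k)%:~R + 1) /\
    2 ^ i * (a.2 ord0 k)%:~R <= z.2 ord0 k < 2 ^ i * ((a.2 ord0 k)%:~R + 1)].

Definition dyadic_center (i : int) (a : 'rV[int]_n * 'rV[int]_n) (b : int) :
    heis R n :=
  (\row_k (2 ^ i * ((a.1 ord0 k)%:~R + 2^-1)),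
   \row_k (2 ^ i * ((a.2 ord0 k)%:~R + 2^-1)),
   2 ^ (2 * i) * (b%:~R + 2^-1)).

(* Only the values of S at scales i in mZ are constrained (and used). *)
Record dyadic_cubes (m : nat)
    (S : int -> 'rV[int]_n * 'rV[int]_n -> int -> set (heis R n)) : Prop := {
  dyadic_cubes_measurable : forall i a b, (m%:Z %| i)%Z -> measurable (S i a b) ;
  dyadic_cubes_partition : forall i, (m%:Z %| i)%Z ->
    partition [set: ('rV[int]_n * 'rV[int]_n) * int]
      (fun ab => S i ab.1 ab.2) [set: heis R n] ;
  dyadic_cubes_nested : forall i l a b a' b',
    (m%:Z %| i)%Z -> (m%:Z %| l)%Z -> i <= l ->
    S i a b `&` S l a' b' !=set0 -> S i a b `<=` S l a' b' ;
  dyadic_cubes_proj : forall i a b, (m%:Z %| i)%Z ->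
    fst @` S i a b = dyadic_base i a ;
  dyadic_cubes_ball : exists c C : R, [/\ 0 < c, 0 < C &
    forall i a b, (m%:Z %| i)%Z ->
      heis_ball (dyadic_center i a b) (c * 2 ^ i) `<=` S i a b /\
      S i a b `<=` heis_ball (dyadic_center i a b) (C * 2 ^ i)] }.

Context (m : nat).
Context (S : int -> 'rV[int]_n * 'rV[int]_n -> int -> set (heis R n)).

(* vertical dyadic rectangles of width 2^i and height 2^(2l) *)
Definition vertical_rect (i l : int) : set (set (heis R n)) :=
  [set A | exists a b a' b', S i a b `<=` S l a' b' /\
    A = \bigcup_(c in [set c | S i a c `<=` S l a' b']) S i a c].

(* the largest element of mZ that is <= r (for m > 0) *)
Definition scale (r : R) : int := m%:Z * Num.floor (r / m%:R).

Context (kappa : R) (N : nat).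

Definition rect_family (j k : int) : set (set (heis R n)) :=
  vertical_rect (scale (- (kappa * (j%:~R + N%:R))))
                (scale (- (kappa * (k%:~R + N%:R)))).

(* The union is indexed by (j, k): several j can have the same scale, and the
   corresponding copies of a rectangle are kept apart. The cubes Q(j) are the
   case j = k. *)
Definition rects_plus : set (int * int * set (heis R n)) :=
  [set r | r.1.2 <= r.1.1 /\ rect_family r.1.1 r.1.2 r.2].

Definition rect_index : choiceType := rects_plus.

Definition rect_set (r : rect_index) : set (heis R n) := (\val (r : rects_plus)).2.

End dyadic.

Arguments rect_index {R n} m S kappa N.
Arguments rect_set {R n} m S kappa N.

(* Normc.normc is the real-valued modulus on R[i]. *)
Section sequence_spaces.
Context {R : realType} {n : nat} {I : choiceType} (E : I -> set (heis R n)).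
Local Notation C := R[i].
Local Notation mu := (@heis_measure R n).
Implicit Types (s t : I -> C) (p : R).

Definition square_function s (x : heis R n) : \bar R :=
  ((\esum_(r in [set: I])
    (Normc.normc (s r) ^+ 2 * (fine (mu (E r)))^-1 * \1_(E r) x)%:E)
   `^ (2^-1))%E.

Definition sp_norm p s : \bar R := Lnorm mu p%:E (square_function s).

Definition sp p : set (I -> C) := [set s | (sp_norm p s < +oo)%E].

(* Omega = set0 contributes 0: no E r is empty, and 0^-1 * 0 = 0. *)
Definition cp_norm p t : \bar R :=
  ereal_sup [set (((fine (mu Omega) `^ (2 / p - 1))^-1)%R%:E *
      \esum_(r in [set r | E r `<=` Omega]) (Normc.normc (t r) ^+ 2)%:E)%E
     `^ (2^-1) | Omega in [set Omega | open Omega /\ (mu Omega < +oo)%E]]%E.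

Definition cp p : set (I -> C) := [set t | (cp_norm p t < +oo)%E].

(* A functional on s^p is a function on all sequences of which only the
   restriction to s^p matters. *)
Definition sp_dual p : set ((I -> C) -> C) :=
  [set l | (forall (a : C) s s', sp p s -> sp p s' ->
              l (a *: s + s') = a * l s + l s') /\
           (forall s0, sp p s0 -> forall e : R, 0 < e ->
              exists2 d : R, 0 < d & forall s, sp p s ->
                (sp_norm p (s - s0)%R < d%:E)%E ->
                Normc.normc (l s - l s0) < e)].

Definition sp_dual_norm p (l : (I -> C) -> C) : \bar R :=
  ereal_sup [set (Normc.normc (l s))%:E | s in [set s | (sp_norm p s <= 1)%E]].

Definition pairing_term s t (r : I) : C^o := s r * (t r)^*.

(* unordered sum: limit of the finite partial sums along the directed set
   of finite subsets of I *)
Definition pairing s t : C := sum (pairing_term s t).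

End sequence_spaces.

(* Main.v *)
(* The key point is a strong covering property: every measurable A of finite
   measure has an open U with |U| <~ |A| that contains every vertical rectangle
   R with |R /\ A| > |R| / 2. Let R have width 2^i and lie in the cube Q of
   scale l, so that R = Q /\ (I x R), I being a dyadic cube of C^n of side 2^i.
   Three coverings by nested families are iterated.
   (1) A1 is the union of the cubes S with |S| <= 4 |S /\ A|; the cubes of
   scale i contained in both R and A1 fill a fixed proportion of R.
   (2) Over a small box at the centre of I, every fibre of a cube S of scale i
   has length about |S| / |I|, so A1 fills a fixed proportion of each fibre of
   R there. These fibres are also fibres of Q, hence a one-dimensional covering
   in each fibre {z} x R, by fibres of cubes, puts the part of R over the
   central box into a set A2 with |A2| <~ |A1|.
   (3) Each cube of scale i in R has a fixed proportion of its measure in A2, so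
   R lies in the union of the cubes S with |S| <~ |S /\ A2|.
   Outer regularity then makes the set open.

   For the upper bound let Omega_j be the set where the square function of s
   exceeds theta 2^j, and assign R to the last j with
   |R /\ Omega_j| > |R| / 2. Covering Omega_j by an open set and applying the
   c^p condition there and the Cauchy-Schwarz inequality bounds the j-th block
   by |Omega_j|^(1/p) 2^j, and these sum to at most a multiple of the norm of s
   since p <= 1. The lower bound comes from testing on s = t restricted to the
   rectangles inside Omega, and a functional is given by its values on the unit
   sequences because the finite sequences are dense in s^p. *)

Require Import Defs.
From mathcomp Require Import all_boot all_order all_algebra.
From mathcomp Require Import all_classical all_reals all_analysis.
From mathcomp Require Import finmap complex.
From mathcomp Require Import showcase.summability measurable_realfun ring lra.
Import Order.TTheory GRing.Theory Num.Theory.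
Import numFieldNormedType.Exports.
Local Open Scope classical_set_scope.
Local Open Scope ring_scope.

Set Implicit Arguments. Unset Strict Implicit. Unset Printing Implicit Defensive.

(** * Nested coverings *)

Section covering.
Context d (T : measurableType d) (R : realType).
Context (mu : {measure set T -> \bar R}).

(** A laminar family. Restricting to [P] allows for cubes being constrained only at scales divisible
    by [m]. *)
Definition nested_family (I : Type) (P : set I) (D : I -> set T) :=
  forall i j, P i -> P j -> D i `&` D j !=set0 ->
    D i `<=` D j \/ D j `<=` D i.

(** Only maximal sets matter. If the head lies in a later set it is dropped; otherwise the later
    sets inside it are dropped and the others are disjoint from it, so both sides are additive. The
    list may shrink by more than one entry, hence the induction on a bound for its size. *)
Lemma finite_nested_cover (I : choiceType) (D : I -> set T) (A : set T) (c : R)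
    (s : seq I) :
  0 <= c -> measurable A -> (forall i, measurable (D i)) ->
  nested_family [set` s] D ->
  (forall i, i \in s -> (mu (D i) <= c%:E * mu (A `&` D i))%E) ->
  (mu (\big[setU/set0]_(i <- s) D i) <=
     c%:E * mu (A `&` \big[setU/set0]_(i <- s) D i))%E.
Proof.
move=> c0 mA mD; have [n] := ubnP (size s).
elim: n s => // n IH [|i s] /= sn nD AD.
  by rewrite big_nil setI0 !measure0 mule0.
rewrite big_cons.
have [[j js ij]|nij] := pselect (exists2 j, j \in s & D i `<=` D j).
  rewrite (setUidr _ : _ = \big[setU/set0]_(k <- s) D k); last first.
    by apply: (subset_trans ij); rewrite -bigcup_seq; exact: bigcup_sup.
  apply: IH => //.
  - by move=> k l /= ks ls; apply: nD; rewrite /= inE (ks, ls) orbT.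
  - by move=> k ks; apply: AD; rewrite inE ks orbT.
pose t := [seq j <- s | ~~ `[< D j `<=` D i >]].
have -> : D i `|` \big[setU/set0]_(j <- s) D j =
          D i `|` \big[setU/set0]_(j <- t) D j.
  rewrite -!bigcup_seq; apply/seteqP; split=> x [Dx|[j /= js Djx]]; try by left.
    have [/asboolP ji|ji] := boolP `[< D j `<=` D i >]; first by left; exact: ji.
    by right; exists j => //=; rewrite mem_filter ji.
  by right; exists j => //; move: js; rewrite /= mem_filter => /andP[].
have Dit : D i `&` \big[setU/set0]_(j <- t) D j = set0.
  rewrite -bigcup_seq; apply/seteqP; split=> // x [Dix [j /=]].
  rewrite mem_filter => /andP[/asboolPn ji js] Djx.
  have [||||] := nD i j; rewrite /= ?inE ?eqxx ?js ?orbT //; first by exists x.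
  by move=> Dij; exfalso; apply: nij; exists j.
have mt : measurable (\big[setU/set0]_(j <- t) D j) by exact: bigsetU_measurable.
rewrite measureU// setIUr measureU//; try exact: measurableI; last first.
  by rewrite setIACA setIid Dit setI0.
rewrite ge0_muleDr//; apply: leeD; first by apply: AD; rewrite mem_head.
apply: IH.
- by rewrite (leq_ltn_trans _ (sn : (size s < n)%N)) // size_filter count_size.
- move=> k l /=; rewrite !mem_filter => /andP[_ ks] /andP[_ ls].
  by apply: nD; rewrite /= inE (ks, ls) orbT.
- by move=> k; rewrite mem_filter => /andP[_ ks]; apply: AD; rewrite inE ks orbT.
Qed.

Lemma bigcup_countType (I : countType) (P : set I) (D : I -> set T) :
  \bigcup_(i in P) D i = \bigcup_k
    (if @pickle_inv I k is Some i then if `[< P i >] then D i else set0 else set0).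
Proof.
apply/seteqP; split=> x.
  by move=> [i Pi Dx]; exists (choice.pickle i) => //; rewrite pickleK_inv asboolT.
by move=> [k _]; case: (@pickle_inv I _) => // i; case: asboolP => // Pi Dx; exists i.
Qed.

Lemma bigcup_countType_measurable (I : countType) (P : set I) (D : I -> set T) :
  (forall i, P i -> measurable (D i)) -> measurable (\bigcup_(i in P) D i).
Proof.
move=> mD; rewrite bigcup_countType; apply: bigcupT_measurable => k.
by case: (@pickle_inv I _) => // i; case: asboolP => // Pi; exact: mD.
Qed.

(** An infinite nested family may have no maximal members, but the finite bound does not depend on
    the number of sets and passes to the union by continuity from below. *)
Lemma nested_cover (I : countType) (P : set I) (D : I -> set T) (A : set T)
    (c : R) :
  0 <= c -> measurable A -> (forall i, P i -> measurable (D i)) ->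
  nested_family P D ->
  (forall i, P i -> (mu (D i) <= c%:E * mu (A `&` D i))%E) ->
  (mu (\bigcup_(i in P) D i) <= c%:E * mu A)%E.
Proof.
move=> c0 mA mD nD AD; rewrite bigcup_countType.
set F := fun k => _.
have mF k : measurable (F k).
  by rewrite /F; case: (@pickle_inv I _) => // i; case: asboolP => // Pi; exact: mD.
rewrite -bigcup_bigsetU_bigcup.
have mB k : measurable (\big[setU/set0]_(i < k) F i) by exact: bigsetU_measurable.
have nB : {homo (fun k => \big[setU/set0]_(i < k.+1) F i) :
    n m / (n <= m)%N >-> (n <= m)%O}.
  by move=> n m nm; apply/subsetPset; exact: subset_bigsetU.
have mBU : measurable (\bigcup_k \big[setU/set0]_(i < k.+1) F i).
  exact: bigcupT_measurable.
have cB := @nondecreasing_cvg_mu _ _ _ mu _ (fun k => mB k.+1) mBU nB.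
rewrite -(cvg_lim _ cB)//; apply: lime_le; first by apply/cvg_ex; eexists; exact: cB.
apply: nearW => k /=.
have -> : \big[setU/set0]_(i < k.+1) F i = \big[setU/set0]_(i <- iota 0 k.+1) F i.
  by rewrite -(big_mkord xpredT F) /index_iota subn0.
apply: le_trans (finite_nested_cover (A := A) c0 mA mF _ _) _.
- move=> i j _ _; rewrite /F.
  case: (@pickle_inv I i) => [i'|]; last by rewrite set0I => -[].
  case: asboolP => [Pi|]; last by rewrite set0I => _ -[].
  case: (@pickle_inv I j) => [j'|]; last by rewrite setI0 => -[].
  case: asboolP => [Pj|]; last by rewrite setI0 => _ -[].
  exact: nD.
- move=> i _; rewrite /F; case: (@pickle_inv I i) => [i'|]; last first.
    by rewrite setI0 !measure0 mule0.
  by case: asboolP => [Pi|_]; [exact: AD|rewrite setI0 !measure0 mule0].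
- rewrite lee_wpmul2l ?lee_fin//; apply: le_measure; rewrite ?in_setE//.
  by apply: measurableI => //; exact: bigsetU_measurable.
Qed.

End covering.

(** Subadditivity on the left, additivity on the right. The two measures may live on different
    spaces, which serves to compare the volume of a stack of cubes with the length of a fibre
    through it. *)
Lemma le_measure_bigcup d d' (T : measurableType d) (T' : measurableType d')
    (R : realType) (mu : {measure set T -> \bar R})
    (nu : {measure set T' -> \bar R}) (I : countType) (P : set I)
    (F : I -> set T) (G : I -> set T') (c : R) :
  0 <= c -> (forall i, P i -> measurable (F i)) ->
  (forall i, P i -> measurable (G i)) -> trivIset P G ->
  (forall i, P i -> (mu (F i) <= c%:E * nu (G i))%E) ->
  (mu (\bigcup_(i in P) F i) <= c%:E * nu (\bigcup_(i in P) G i))%E.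
Proof.
move=> c0 mF mG tG FG; rewrite (bigcup_countType P F) (bigcup_countType P G).
set F' := (X in mu (\bigcup_k X k)); set G' := (X in nu (\bigcup_k X k)).
have mF' k : measurable (F' k).
  by rewrite /F'; case: (@pickle_inv I _) => // i; case: asboolP => // Pi; exact: mF.
have mG' k : measurable (G' k).
  by rewrite /G'; case: (@pickle_inv I _) => // i; case: asboolP => // Pi; exact: mG.
apply: le_trans (generalized_Boole_inequality mu mF' _) _.
  exact: bigcupT_measurable.
rewrite measure_semi_bigcup//; last 2 first.
- move=> i j _ _; rewrite /G'.
  case ei : (@pickle_inv I i) => [i'|]; last by rewrite set0I => -[].
  case: asboolP => [Pi|]; last by rewrite set0I => _ -[].
  case ej : (@pickle_inv I j) => [j'|]; last by rewrite setI0 => -[].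
  case: asboolP => [Pj|]; last by rewrite setI0 => _ -[].
  move=> /(tG _ _ Pi Pj) ij.
  have := @pickle_invK I i; have := @pickle_invK I j.
  by rewrite ei ej ij /= => <-.
- exact: bigcupT_measurable.
rewrite -nneseriesZl//; apply: lee_nneseries => // k _.
rewrite /F' /G'; case: (@pickle_inv I _) => [i|]; last by rewrite !measure0 mule0.
by case: asboolP => [Pi|_]; [exact: FG|rewrite !measure0 mule0].
Qed.

(** * Topology and measure on the Heisenberg group *)

Section heis_topology.
Context (R : realType) (n : nat).
Local Notation H := (heis R n).

(** One finite index type for the [2n + 1] real coordinates turns a box into a single finite
    intersection. *)
Definition heis_coord (c : option ('I_n + 'I_n)) (x : H) : R :=
  match c with
  | Some (inl k) => x.1.1 ord0 k
  | Some (inr k) => x.1.2 ord0 k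
  | None => x.2
  end.

Lemma measurable_heis_coord c : measurable_fun [set: H] (heis_coord c).
Proof.
case: c => [[k|k]|].
- exact: (measurableT_comp (measurable_rV_coord (T := R) k)
    (measurableT_comp measurable_fst measurable_fst)).
- exact: (measurableT_comp (measurable_rV_coord (T := R) k)
    (measurableT_comp measurable_snd measurable_fst)).
- exact: measurable_snd.
Qed.

Lemma continuous_heis_coord c : continuous (heis_coord c).
Proof.
case: c => [[k|k]|] x; rewrite /heis_coord.
- apply: (@continuous_comp H 'rV[R]_n R (fun x => x.1.1) (fun v => v ord0 k)).
    apply: (@continuous_comp H _ 'rV[R]_n fst fst); exact: cvg_fst.
  exact: coord_continuous.
- apply: (@continuous_comp H 'rV[R]_n R (fun x => x.1.2) (fun v => v ord0 k)).
    apply: (@continuous_comp H _ 'rV[R]_n fst snd); [exact: cvg_fst|exact: cvg_snd].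
  exact: coord_continuous.
- exact: cvg_snd.
Qed.

Lemma heis_openP (U : set H) (x : H) : open U -> U x ->
  exists2 e : R, 0 < e &
    forall y, (forall c, `|heis_coord c x - heis_coord c y| < e) -> U y.
Proof.
move=> oU Ux; have /nbhs_ballP[e /= e0 xeU] : nbhs x U by exact: open_nbhs_nbhs.
exists e => // y xy; apply: xeU; split; [split|] => /=.
- by split => // i j; rewrite (ord1 i); exact: (xy (Some (inl j))).
- by split => // i j; rewrite (ord1 i); exact: (xy (Some (inr j))).
- exact: (xy None).
Qed.

(** The sigma-algebra is the product one, so measurability of open sets comes from second
    countability: an open set is the union of the rational boxes inside it. *)
Lemma open_heis_measurable (U : set H) : open U -> measurable U.
Proof.
move=> oU.
pose box (q : {ffun option ('I_n + 'I_n) -> rat} * rat) : set H :=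
  \bigcap_(c in setT) [set x | `|ratr (q.1 c) - heis_coord c x| < ratr q.2].
have mbox q : measurable (box q).
  apply: fin_bigcap_measurable => [|c _]; first exact: finite_finset.
  rewrite [X in measurable X](_ : _ =
    heis_coord c @^-1` (ball (ratr (q.1 c) : R) (ratr q.2)))//.
  rewrite -[X in measurable X]setTI.
  by apply: measurable_heis_coord => //; exact: measurable_ball.
rewrite (_ : U = \bigcup_(q in [set q | box q `<=` U]) box q).
  by apply: bigcup_countType_measurable.
apply/seteqP; split=> [x Ux|x [q /= qU /qU]//].
have [e e0 xeU] := heis_openP oU Ux.
(* A half-width below [e / 2] and a centre within that half-width of [x] keep the whole box within
   [e] of [x]. *)
have e20 : 0 < e / 2 by rewrite divr_gt0.
have [r] := rat_in_itvoo e20; rewrite in_itv/= => /andP[r0 re].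
have /choice[q qP] : forall c, exists q : rat,
    `|ratr q - heis_coord c x| < ratr r :> R.
  move=> c; have : heis_coord c x < heis_coord c x + ratr r by rewrite ltrDl.
  move=> /rat_in_itvoo[q]; rewrite in_itv/= => /andP[xq qx]; exists q.
  by rewrite gtr0_norm ?subr_gt0// ltrBlDl.
exists ([ffun c => q c], r) => [y /= yq|c _ /=]; last by rewrite ffunE; exact: qP.
apply: xeU => c; have := yq c I; rewrite /= ffunE => qy.
rewrite -(subrKA (ratr (q c))) (le_lt_trans (ler_normD _ _))//.
by rewrite (splitr e) distrC ltrD// (lt_trans _ re).
Qed.

End heis_topology.

(** * Outer regularity of the measure *)

Lemma nonincreasing_measure_lt d (T : measurableType d) (R : realType)
    (nu : {measure set T -> \bar R}) (F : (set T)^nat) (e : \bar R) :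
  (nu setT < +oo)%E -> (forall i, measurable (F i)) ->
  {homo F : n m / (n <= m)%N >-> (m <= n)%O} ->
  (nu (\bigcap_i F i) < e)%E -> exists i, (nu (F i) < e)%E.
Proof.
move=> nuT mF dF; apply: contraPP => /forallNP eF.
have mI : measurable (\bigcap_i F i) by exact: bigcapT_measurable.
have F0 : (nu (F 0%N) < +oo)%E.
  by rewrite (le_lt_trans _ nuT)//; apply: le_measure; rewrite ?in_setE.
have cF := nonincreasing_cvg_mu F0 mF mI dF.
apply/negP; rewrite -leNgt -(cvg_lim _ cF)//; apply: lime_ge.
  by apply/cvg_ex; eexists; exact: cF.
by apply: nearW => i /=; rewrite leNgt; exact/negP/eF.
Qed.

Section heis_regularity.
Context (R : realType) (n : nat).
Local Notation H := (heis R n).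

(** Approximation from both sides, because this is stable under complements; outer approximation
    alone is not. *)
Definition regular_set (nu : set H -> \bar R) (A : set H) :=
  measurable A /\ forall e : R, 0 < e -> exists F O : set H,
    [/\ closed F, open O, F `<=` A, A `<=` O & (nu (O `\` F) < e%:E)%E].

Lemma closed_heis_measurable (F : set H) : closed F -> measurable F.
Proof.
move=> cF; rewrite -(setCK F); apply: measurableC; apply: open_heis_measurable.
exact: closed_openC.
Qed.

(** Half-spaces generate the product sigma-algebra: the class is transported along the coordinates,
    then the vectors, then the base projection, each time through an image sigma-algebra. *)
Lemma measurable_heis_sub (G : set (set H)) : sigma_algebra setT G ->
  (forall c (a : R), G (heis_coord c @^-1` `]a, +oo[)) ->
  measurable `<=` G.
Proof.
move=> sG GG.
have coordG c (B : set R) : measurable B -> G (heis_coord c @^-1` B).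
  move=> mB; have {}mB : (@ocitv R).-sigma.-measurable B by [].
  rewrite RGenOInfty.measurableE in mB.
  have : <<s @RGenOInfty.G R >> `<=` image_set_system setT (@heis_coord R n c) G.
    apply: smallest_sub; first exact: sigma_algebra_image.
    by move=> _ [a ->]; rewrite /image_set_system/= setTI; exact: GG.
  by move=> /(_ B mB); rewrite /image_set_system/= setTI.
have rVG (f : H -> 'rV[R]_n) :
    (forall k, exists c, (fun x => f x ord0 k) = heis_coord c) ->
    forall B : set 'rV[R]_n, measurable B -> G (f @^-1` B).
  move=> fc B mB.
  have : measurable `<=` image_set_system setT f G.
    apply: smallest_sub; first exact: sigma_algebra_image.
    move=> A; rewrite -bigcup_seq => -[k _ [D mD <-]].
    have [c kc] := fc k; rewrite /image_set_system/= !setTI.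
    rewrite -[X in G X]/((fun x => f x ord0 k) @^-1` D) kc; exact: coordG.
  by move=> /(_ B mB); rewrite /image_set_system/= setTI.
have fstG (B : set ('rV[R]_n * 'rV[R]_n)) : measurable B -> G (fst @^-1` B).
  move=> mB; have : measurable `<=` image_set_system setT (@fst _ (measurableTypeR R)) G.
    apply: smallest_sub; first exact: sigma_algebra_image.
    move=> _ [[D mD <-]|[D mD <-]]; rewrite /image_set_system/= !setTI.
      by apply: (rVG (fun x => x.1.1)) => // k; exists (Some (inl k)).
    by apply: (rVG (fun x => x.1.2)) => // k; exists (Some (inr k)).
  by move=> /(_ B mB); rewrite /image_set_system/= setTI.
apply: smallest_sub => // _ [[B mB <-]|[B mB <-]]; rewrite setTI.
  exact: fstG.
exact: (coordG None).
Qed.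

(** For a countable union all the open sets are kept but only finitely many closed ones, since an
    infinite union of closed sets need not be closed. Finite total mass makes the loss small by
    continuity from above. *)
Lemma regular_set_sigma_algebra (nu : {measure set H -> \bar R}) :
  (nu setT < +oo)%E -> sigma_algebra setT (regular_set nu).
Proof.
move=> nuT; split.
- split=> // e e0; exists set0, set0; split => //; first exact: closed0.
  by rewrite setD0 measure0 lte_fin.
- move=> A [mA rA]; rewrite setTD; split; first exact: measurableC.
  move=> e /rA[F [U [cF oU FA AU nue]]]; exists (~` U), (~` F); split.
  + exact: open_closedC.
  + exact: closed_openC.
  + exact: subsetC.
  + exact: subsetC.
  + by rewrite setDE setCK setIC -setDE.
- move=> A rA; split; first by apply: bigcupT_measurable => i; have [] := rA i.
  move=> e e0.
  (* The errors sum to [e / 2], which leaves room for a strict bound by [e]. *)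
  have e2 i : 0 < e / 2 / (2 ^ i.+1)%:R.
    by rewrite !divr_gt0// ltr0n expn_gt0.
  have /choice[FO FOP] i : exists FO : set H * set H, [/\ closed FO.1, open FO.2,
      FO.1 `<=` A i, A i `<=` FO.2 &
      (nu (FO.2 `\` FO.1) < (e / 2 / (2 ^ i.+1)%:R)%:E)%E].
    by have [_ /(_ _ (e2 i))[F [U ?]]] := rA i; exists (F, U).
  pose F i := (FO i).1; pose O i := (FO i).2.
  have mF i : measurable (F i) by apply: closed_heis_measurable; have [] := FOP i.
  have mO i : measurable (O i) by apply: open_heis_measurable; have [] := FOP i.
  pose E k := (\bigcup_i O i) `\` (\big[setU/set0]_(i < k) F i).
  have mE k : measurable (E k).
    apply: measurableD; first exact: bigcupT_measurable.
    exact: bigsetU_measurable.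
  have [k nuE] : exists k, (nu (E k) < e%:E)%E.
    apply: nonincreasing_measure_lt => //.
      move=> i j ij; apply/subsetPset; apply: setDS; exact: subset_bigsetU.
    apply: (@le_lt_trans _ _ (e / 2)%:E); last first.
      by rewrite lte_fin ltr_pdivrMr// ltr_pMr// ltr1n.
    apply: (@le_trans _ _ (nu (\bigcup_i (O i `\` F i)))).
      apply: le_measure; rewrite ?in_setE.
      - exact: bigcapT_measurable.
      - by apply: bigcupT_measurable => i; exact: measurableD.
      - move=> x Ex; have [[i _ Oix] _] := Ex 0%N I; exists i => //; split => //.
        move=> Fix; have [_] := Ex i.+1 I; apply.
        by rewrite big_ord_recr; right.
    apply: le_trans (generalized_Boole_inequality nu _ _) _.
      + by move=> i; exact: measurableD.
      + by apply: bigcupT_measurable => i; exact: measurableD.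
    apply: le_trans (epsilon_trick0 xpredT _); last by rewrite divr_ge0// ltW.
    apply: lee_nneseries => // i _; apply: ltW; by have [] := FOP i.
  exists (\big[setU/set0]_(i < k) F i), (\bigcup_i O i); split => //.
  + rewrite -bigcup_mkord; apply: closed_bigcup; first exact: finite_II.
    by move=> i _; have [] := FOP i.
  + by apply: bigcup_open => i _; have [] := FOP i.
  + rewrite -bigcup_mkord => x [i _ Fx]; exists i => //.
    by have [_ _ + _ _] := FOP i; exact.
  + move=> x [i _ Ax]; exists i => //; by have [_ _ _ + _] := FOP i; exact.
Qed.

(** An open half-space is an increasing union of closed half-spaces, and half-spaces generate the
    sigma-algebra. *)
Lemma measurable_heis_regular (nu : {measure set H -> \bar R}) (A : set H) :
  (nu setT < +oo)%E -> measurable A -> regular_set nu A.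
Proof.
move=> nuT; apply: measurable_heis_sub; first exact: regular_set_sigma_algebra.
move=> c a; pose O : set H := heis_coord c @^-1` `]a, +oo[.
pose F (k : nat) : set H := heis_coord c @^-1` `[a + k.+1%:R^-1, +oo[.
have oO : open O.
  apply: open_comp; last exact: interval_open.
  by move=> x _; exact: continuous_heis_coord.
have cF k : closed (F k).
  apply: closed_comp; last exact: interval_closed.
  by move=> x _; exact: continuous_heis_coord.
have mO := open_heis_measurable oO.
have mF k := closed_heis_measurable (cF k).
have FO k : F k `<=` O.
  move=> x; rewrite /F /O /= !in_itv/= !andbT; apply: lt_le_trans.
  by rewrite ltrDl.
split => // e e0.
have [k nuk] : exists k, (nu (O `\` F k) < e%:E)%E.
  apply: nonincreasing_measure_lt => //.
  - by move=> k; exact: measurableD.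
  - move=> k l kl; apply/subsetPset; apply: setDS => x.
    rewrite /F /= !in_itv/= !andbT; apply: le_trans.
    by rewrite lerD2l lef_pV2 ?posrE// ler_nat.
  - rewrite (_ : \bigcap_k _ = set0) ?measure0 ?lte_fin//.
    apply/seteqP; split => // x Fx.
    have [] := Fx 0%N I; rewrite /O /= in_itv/= andbT => ax _.
    have /= := near_infty_natSinv_lt (PosNum (_ : 0 < heis_coord c x - a)).
    rewrite subr_gt0 => /(_ ax)[k _ /(_ k (leqnn k)) /=] kx.
    have [_] := Fx k I; apply; rewrite /F /= in_itv/= andbT.
    by rewrite -lerBrDl ltW.
by exists (F k), O; split => //; exact: FO.
Qed.

Local Notation mu := (@heis_measure R n).

Definition base_measure : {measure set ('rV[R]_n * 'rV[R]_n) -> \bar R} :=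
  (lebesgue_rV R n \x lebesgue_rV R n)%E.

Lemma base_measureE (A B : set 'rV[R]_n) : measurable A -> measurable B ->
  base_measure (A `*` B) = (lebesgue_rV R n A * lebesgue_rV R n B)%E.
Proof. exact: product_measure1E. Qed.

Lemma heis_measureE (A : set ('rV[R]_n * 'rV[R]_n)) (B : set (measurableTypeR R)) :
  measurable A -> measurable B ->
  mu (A `*` B) = (base_measure A * @lebesgue_measure R B)%E.
Proof. exact: product_measure1E. Qed.

Lemma heis_measure_xsection (A : set H) :
  mu A = (\int[base_measure]_z @lebesgue_measure R (xsection A z))%E.
Proof. by []. Qed.

(** Bounded boxes exhausting the space: the total measure is infinite, so regularity is first
    obtained inside each of them. *)
Definition heis_box (k : nat) : set H :=
  \bigcap_(c in setT) heis_coord c @^-1` [set` `]- k.+1%:R, k.+1%:R[].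

Lemma heis_box_measure_fin k : (mu (heis_box k) < +oo)%E.
Proof.
pose J : set R := [set` `]- k.+1%:R, k.+1%:R[].
pose B : set 'rV[R]_n := [set v | forall i, J (v ord0 i)].
have mB : measurable B.
  rewrite (_ : B = \bigcap_(i in setT) (fun v : 'rV[R]_n => v ord0 i) @^-1` J).
    apply: fin_bigcap_measurable => [|i _]; first exact: finite_finset.
    rewrite -[X in measurable X]setTI; apply: measurable_rV_coord => //.
    exact: measurable_itv.
  by apply/seteqP; split => v Bv i; [move=> _|]; exact: Bv.
have Bfin : (lebesgue_rV R n B < +oo)%E.
  rewrite (lebesgue_rV_box (A := fun=> J)) => [|i]; last exact: measurable_itv.
  rewrite -ge0_fin_numE; last by rewrite prode_ge0.
  by apply: prode_fin_num => i _; rewrite lebesgue_measure_itv/=; case: ifP.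
have -> : heis_box k = (B `*` B) `*` J.
  apply/seteqP; split => [x xk|x [[/= x1 x2] x3] c _].
    split; last exact: (xk None I).
    split => i; first exact: (xk (Some (inl i)) I).
    exact: (xk (Some (inr i)) I).
  by case: c => [[i|i]|]; [exact: x1|exact: x2|exact: x3].
have fB : base_measure (B `*` B) \is a fin_num.
  rewrite base_measureE// ge0_fin_numE ?mule_ge0//.
  by rewrite lte_mul_pinfty// ge0_fin_numE.
rewrite heis_measureE//; [|exact: measurableX|exact: measurable_itv].
by rewrite lte_mul_pinfty// lebesgue_measure_itv/=; case: ifP; rewrite ?ltry.
Qed.

Lemma heis_outer_regular (A : set H) (e : R) :
  measurable A -> 0 < e ->
  exists U : set H, [/\ open U, A `<=` U & (mu U <= mu A + e%:E)%E].
Proof.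
move=> mA e0.
have oB k : open (heis_box k).
  rewrite -closedC setC_bigcap; apply: closed_bigcup; first exact: finite_finset.
  move=> c _; apply: open_closedC; apply: open_comp; last exact: interval_open.
  by move=> x _; exact: continuous_heis_coord.
have mB k : measurable (heis_box k) by exact: open_heis_measurable.
(* The restriction of the measure to a box is finite. *)
have rA k : regular_set (mrestr mu (mB k)) A.
  apply: measurable_heis_regular => //.
  change (mu (setT `&` heis_box k) < +oo)%E.
  by rewrite setTI heis_box_measure_fin.
have e2 i : 0 < e / (2 ^ i.+1)%:R by rewrite !divr_gt0// ltr0n expn_gt0.
have /choice[V VP] k : exists V : set H, [/\ open V, A `<=` V &
    (mu ((V `&` heis_box k) `\` A) < (e / (2 ^ k.+1)%:R)%:E)%E].
  have [_ /(_ _ (e2 k))[F [V [cF oV FA AV VF]]]] := rA k.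
  exists V; split => //.
  have {}VF : (mu ((V `\` F) `&` heis_box k) < (e / (2 ^ k.+1)%:R)%:E)%E := VF.
  apply: le_lt_trans VF.
  have mV := open_heis_measurable oV; have mF := closed_heis_measurable cF.
  apply: le_measure; rewrite ?in_setE.
  - by apply: measurableD => //; exact: measurableI.
  - by apply: measurableI => //; exact: measurableD.
  - by move=> x [[Vx Bx] nAx]; split => //; split => // /FA.
have mV k : measurable (V k) by apply: open_heis_measurable; have [] := VP k.
have mVB k : measurable (V k `&` heis_box k) by exact: measurableI.
(* Each [V k] is controlled only inside the box [k], so only that part enters the union; every point
   of [A] lies in some box. *)
exists (\bigcup_k (V k `&` heis_box k)); split.
- by apply: bigcup_open => k _; apply: openI => //; have [] := VP k.
- move=> x Ax; pose M : R := \big[Num.max/0]_c `|heis_coord c x|.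
  have [k Mk] : exists k : nat, M < k.+1%:R.
    exists (Num.truncn M); exact: truncnS_gt.
  exists k => //; split; first by have [_ + _] := VP k; exact.
  move=> c _ /=; rewrite in_itv/= -ltr_norml (le_lt_trans _ Mk)//.
  exact: le_bigmax.
- have mU : measurable (\bigcup_k (V k `&` heis_box k)) by exact: bigcupT_measurable.
  rewrite (le_trans (_ : _ <= mu (A `|` (\bigcup_k (V k `&` heis_box k) `\` A)))%E)//.
    apply: le_measure; rewrite ?in_setE//.
      by apply: measurableU => //; exact: measurableD.
    by move=> x Ux; have [Ax|nAx] := pselect (A x); [left|right].
  rewrite measureU//; [|exact: measurableD|by rewrite setDE setICA setICr setI0].
  rewrite leeD2l//.
  apply: (@le_trans _ _ (mu (\bigcup_k ((V k `&` heis_box k) `\` A)))).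
    apply: le_measure; rewrite ?in_setE.
    - exact: measurableD.
    - by apply: bigcupT_measurable => k; exact: measurableD.
    - by move=> x [[k _ ?] ?]; exists k.
  apply: le_trans (generalized_Boole_inequality mu _ _) _.
  - by move=> k; exact: measurableD.
  - by apply: bigcupT_measurable => k; exact: measurableD.
  apply: le_trans (epsilon_trick0 xpredT (ltW e0)).
  by apply: lee_nneseries => // k _; apply: ltW; have [] := VP k.
Qed.

End heis_regularity.

(** * Dyadic cubes and rectangles *)

Section heis_geometry.
Context (R : realType) (n : nat).
Local Notation H := (heis R n).
Local Notation mu := (@heis_measure R n).
Local Notation lam := (@lebesgue_measure R).
Local Notation base := (@base_measure R n).

Definition heis_base_dist2 (z w : 'rV[R]_n * 'rV[R]_n) : R :=
  \sum_(k < n) ((z.1 ord0 k - w.1 ord0 k) ^+ 2 + (z.2 ord0 k - w.2 ord0 k) ^+ 2).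

Lemma heis_base_dist2_ge0 z w : 0 <= heis_base_dist2 z w.
Proof. by apply: sumr_ge0 => k _; rewrite addr_ge0// sqr_ge0. Qed.

(* The last coordinate of [heis_mul (z, t) (heis_inv x)] is
   [t - heis_height x z]. *)
Definition heis_height (x : H) (z : 'rV[R]_n * 'rV[R]_n) : R :=
  x.2 - 2 * complex.Im
    (\sum_(k < n) @heis_z R n (z, 0) k * (heis_z (heis_inv x) k)^*)%C.

(** The fourth power of [heis_rho] removes the root. The twist of the group law only moves the
    centre of the fibre over [z] and leaves its length alone. *)
Lemma heis_ballE (x : H) (r : R) z t : 0 < r ->
  heis_ball x r (z, t) <->
  heis_base_dist2 z x.1 ^+ 2 + (t - heis_height x z) ^+ 2 < r ^+ 4.
Proof.
move=> r0; rewrite /heis_ball/= /heis_dist /heis_rho.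
set u := (X in X `^ _); set v := (X in _ <-> X < _).
have -> : u = v.
  rewrite /u /v; congr (_ ^+ 2 + _ ^+ 2).
    apply: eq_bigr => k _; rewrite /heis_z /= !mxE sqr_sqrtr//.
    by rewrite addr_ge0// sqr_ge0.
  by rewrite /heis_height /= opprB addrA addrAC.
have v0 : 0 <= v by rewrite addr_ge0// sqr_ge0.
have rE : r = (r ^+ 4) `^ 4^-1.
  by rewrite -powR_mulrn ?ltW// -powRrM mulfV ?powRr1 ?ltW// pnatr_eq0.
rewrite {1}rE; split => [|vr].
  rewrite !ltNge; apply: contra => rv; apply: ge0_ler_powR => //.
  - by rewrite nnegrE exprn_ge0// ltW.
apply: gt0_ltr_powR => //; rewrite ?nnegrE// exprn_ge0// ltW//.
Qed.

Lemma lebesgue_measure_centered (T s : R) : 0 < s ->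
  lam [set` `]T - s, T + s[] = (2 * s)%:E.
Proof.
move=> s0; rewrite lebesgue_measure_itv/= lte_fin ifT; last by lra.
by rewrite -EFinB; congr EFin; ring.
Qed.

Lemma ltr_sqr_dist (t T s : R) : 0 < s ->
  ((t - T) ^+ 2 < s ^+ 2) = (T - s < t < T + s).
Proof.
move=> s0; rewrite -ltr_distl -[in LHS]real_normK ?num_real//.
by rewrite ltr_pXn2r// nnegrE ltW.
Qed.

(** Dropping the base term leaves an interval of half-length [r ^+ 2]. *)
Lemma heis_ball_xsection_le (A : set H) (x : H) (r : R) z :
  measurable A -> 0 < r -> A `<=` heis_ball x r ->
  (lam (xsection A z) <= (2 * r ^+ 2)%:E)%E.
Proof.
move=> mA r0 Ar; set T := heis_height x z.
rewrite -(lebesgue_measure_centered T); last exact: exprn_gt0.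
apply: le_measure; rewrite ?in_setE.
- exact: measurable_xsection.
- exact: measurable_itv.
- move=> t; rewrite /xsection/= => /set_mem Azt; have xt := Ar _ Azt.
  have := (heis_ballE x z t r0).1 xt; rewrite -/T in_itv/= => h.
  have : (t - T) ^+ 2 < (r ^+ 2) ^+ 2.
    by rewrite -exprM; apply: le_lt_trans h; rewrite lerDr sqr_ge0.
  by rewrite ltr_sqr_dist// exprn_gt0.
Qed.

(** The base term uses at most a quarter of [r ^+ 4], so an interval of half-length [r ^+ 2 / 2]
    still fits. *)
Lemma heis_ball_xsection_ge (A : set H) (x : H) (r : R) z :
  measurable A -> 0 < r -> heis_ball x r `<=` A ->
  heis_base_dist2 z x.1 <= r ^+ 2 / 2 ->
  ((r ^+ 2)%:E <= lam (xsection A z))%E.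
Proof.
move=> mA r0 rA zx; set T := heis_height x z.
have r20 : 0 < r ^+ 2 by exact: exprn_gt0.
rewrite (_ : r ^+ 2 = 2 * (r ^+ 2 / 2)); last by field.
rewrite -(lebesgue_measure_centered T); last by rewrite divr_gt0.
apply: le_measure; rewrite ?in_setE.
- exact: measurable_itv.
- exact: measurable_xsection.
- move=> t; rewrite /xsection/= in_itv/= => tT; apply: mem_set.
  apply: rA; apply/(heis_ballE x z t r0); rewrite -/T.
  have h1 : heis_base_dist2 z x.1 ^+ 2 <= (r ^+ 2 / 2) ^+ 2.
    by rewrite ler_pXn2r// nnegrE ?heis_base_dist2_ge0// divr_ge0// ltW.
  have h2 : (t - T) ^+ 2 < (r ^+ 2 / 2) ^+ 2.
    by rewrite ltr_sqr_dist// divr_gt0.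
  have r40 : 0 < r ^+ 2 * r ^+ 2 by rewrite mulr_gt0.
  rewrite (_ : r ^+ 4 = r ^+ 2 * r ^+ 2); last by ring.
  move: h1 h2 r40; rewrite !(expr2 (r ^+ 2 / 2)); set u := _ ^+ 2; set v := _ ^+ 2.
  set w := r ^+ 2; lra.
Qed.

Definition rV_cube (lo : 'rV[R]_n) (w : R) : set 'rV[R]_n :=
  [set v | forall k, [set` `[lo ord0 k, lo ord0 k + w[] (v ord0 k)].

Lemma measurable_rV_cube lo w : measurable (rV_cube lo w).
Proof.
rewrite (_ : rV_cube lo w = \bigcap_(k in setT)
    (fun v : 'rV[R]_n => v ord0 k) @^-1` [set` `[lo ord0 k, lo ord0 k + w[]).
  apply: fin_bigcap_measurable => [|k _]; first exact: finite_finset.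
  by rewrite -[X in measurable X]setTI; apply: measurable_rV_coord.
by apply/seteqP; split => v Bv k; [move=> _|]; exact: Bv.
Qed.

Lemma lebesgue_rV_cube lo w : 0 < w ->
  lebesgue_rV R n (rV_cube lo w) = (w ^+ n)%:E.
Proof.
move=> w0.
rewrite (lebesgue_rV_box (A := fun k => [set` `[lo ord0 k, lo ord0 k + w[])).
  rewrite (eq_bigr (fun=> w%:E)) => [|k _].
    by rewrite prodEFin prodr_const card_ord.
  by rewrite lebesgue_measure_itv/= lte_fin ltrDl w0 -EFinB addrAC subrr add0r.
by move=> k; exact: measurable_itv.
Qed.

Definition base_cube (lo : 'rV[R]_n * 'rV[R]_n) (w : R) :=
  rV_cube lo.1 w `*` rV_cube lo.2 w.

Lemma measurable_base_cube lo w : measurable (base_cube lo w).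
Proof. by apply: measurableX; exact: measurable_rV_cube. Qed.

Lemma base_measure_cube lo w : 0 < w ->
  base (base_cube lo w) = (w ^+ (n + n))%:E.
Proof.
move=> w0; rewrite base_measureE; try exact: measurable_rV_cube.
by rewrite !lebesgue_rV_cube// -EFinM exprD.
Qed.

Definition dyadic_corner (i : int) (a : 'rV[int]_n * 'rV[int]_n) :
    'rV[R]_n * 'rV[R]_n :=
  (\row_k (2 ^ i * (a.1 ord0 k)%:~R), \row_k (2 ^ i * (a.2 ord0 k)%:~R)).

Lemma dyadic_baseE i a : dyadic_base i a = base_cube (dyadic_corner i a) (2 ^ i).
Proof.
apply/seteqP; split=> z /=.
  move=> za; split=> k /=; rewrite in_itv/= mxE -[X in _ + X]mulr1 -mulrDr;
    by have [] := za k.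
move=> [z1 z2] k; have := z1 k; have := z2 k.
by rewrite /= !in_itv/= !mxE !mulrDr !mulr1 => -> ->.
Qed.

Lemma dyadic_base_inj i a a' (z : 'rV[R]_n * 'rV[R]_n) :
  dyadic_base i a z -> dyadic_base i a' z -> a = a'.
Proof.
have inj (u v : int) (x : R) : 2 ^ i * u%:~R <= x < 2 ^ i * (u%:~R + 1) ->
    2 ^ i * v%:~R <= x < 2 ^ i * (v%:~R + 1) -> u = v.
  move=> /andP[ux xu] /andP[vx xv].
  have i0 : 0 < 2 ^ i :> R by rewrite exprz_gt0.
  have := le_lt_trans ux xv; rewrite ltr_pM2l// -intrD1 ltr_int ltzD1 => uv.
  have := le_lt_trans vx xu; rewrite ltr_pM2l// -intrD1 ltr_int ltzD1 => vu.
  by apply/eqP; rewrite eq_le uv.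
case: a a' => [a b] [a' b'] za za'; congr pair; apply/rowP => k.
  by have [/inj h _] := za k; apply: h; have [] := za' k.
by have [_ /inj h] := za k; apply: h; have [] := za' k.
Qed.

(** The cube of side [2 * eta * 2 ^ i] around the centre of the dyadic cube; for small [eta] the
    fibres of a cube of scale [i] over it are long. *)
Definition center_base (eta : R) (i : int) (a : 'rV[int]_n * 'rV[int]_n) :=
  base_cube ((\row_k (2 ^ i * ((a.1 ord0 k)%:~R + 2^-1 - eta))),
             (\row_k (2 ^ i * ((a.2 ord0 k)%:~R + 2^-1 - eta))))
            (2 ^ i * (2 * eta)).

Lemma center_base_dist2 eta i a b z : 0 <= eta -> center_base eta i a z ->
  heis_base_dist2 z (dyadic_center i a b).1 <=
    n%:R * (2 * (eta * 2 ^ i) ^+ 2).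
Proof.
move=> eta0 [z1 z2].
have i0 : 0 < 2 ^ i :> R by rewrite exprz_gt0.
have sq (x u : R) : 2 ^ i * (u - eta) <= x < 2 ^ i * (u - eta) + 2 ^ i * (2 * eta) ->
    (x - 2 ^ i * u) ^+ 2 <= (eta * 2 ^ i) ^+ 2.
  move=> /andP[h1 h2]; rewrite -[leLHS]real_normK ?num_real//.
  rewrite ler_pXn2r ?nnegrE ?normr_ge0 ?mulr_ge0 ?(ltW i0)//.
  rewrite ler_norml; apply/andP; split; nra.
rewrite /heis_base_dist2 mulr_natl -[X in _ *+ X]card_ord -sumr_const.
apply: ler_sum => k _; rewrite mulr_natl mulr2n lerD//.
  by have := z1 k; rewrite /= in_itv/= !mxE => /sq.
by have := z2 k; rewrite /= in_itv/= !mxE => /sq.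
Qed.

End heis_geometry.

(** * Measure of dyadic cubes and length of their fibres *)

Section dyadic_cube_measure.
Context (R : realType) (n m : nat).
Local Notation H := (heis R n).
Local Notation mu := (@heis_measure R n).
Local Notation lam := (@lebesgue_measure R).
Local Notation base := (@base_measure R n).

Lemma measurable_fun_lam_xsection (A : set H) : measurable A ->
  measurable_fun setT (fun z => lam (xsection A z)).
Proof. by move=> mA; exact: measurable_fun_xsection. Qed.

Lemma heis_measure_le_xsection (A : set H) (B : set ('rV[R]_n * 'rV[R]_n)) (k : R) :
  measurable A -> measurable B -> 0 <= k -> A `<=` fst @^-1` B ->
  (forall z, (lam (xsection A z) <= k%:E)%E) -> (mu A <= k%:E * base B)%E.
Proof.
move=> mA mB k0 AB Ak; rewrite heis_measure_xsection.
rewrite -(setIT B) -integral_indic// -ge0_integralZl//; last exact/measurable_EFinP.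
apply: ge0_le_integral => //.
- exact: measurable_fun_lam_xsection.
- by apply: measurable_funeM; exact/measurable_EFinP.
- move=> z _; rewrite indicE; have [zB|zB] := boolP (z \in B).
    by rewrite mule1.
  rewrite mule0 (_ : xsection A z = set0) ?measure0//.
  apply/seteqP; split => // t; rewrite /xsection/= => /set_mem /AB/= Bz.
  by move: zB; rewrite notin_setE.
Qed.

Lemma heis_measure_ge_xsection (A : set H) (B : set ('rV[R]_n * 'rV[R]_n)) (k : R) :
  measurable A -> measurable B -> 0 <= k ->
  (forall z, B z -> (k%:E <= lam (xsection A z))%E) -> (k%:E * base B <= mu A)%E.
Proof.
move=> mA mB k0 Ak; rewrite heis_measure_xsection.
rewrite -(setIT B) -integral_indic// -ge0_integralZl//; last exact/measurable_EFinP.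
apply: ge0_le_integral => //.
- by move=> z _; rewrite mule_ge0// lee_fin.
- by apply: measurable_funeM; exact/measurable_EFinP.
- exact: measurable_fun_lam_xsection.
- move=> z _; rewrite indicE; have [zB|zB] := boolP (z \in B).
    by rewrite mule1; apply: Ak; exact: set_mem.
  by rewrite mule0.
Qed.

Context (S : int -> 'rV[int]_n * 'rV[int]_n -> int -> set H).
Hypotheses (n0 : (0 < n)%N) (DS : dyadic_cubes m S).

(** With [q = 2 ^ i], all fibres have length at most [2 (C q)^2], and those over the central box at
    least [(c q)^2]. As [v i] is the volume of the base cube, the last two bounds say that a fibre
    has length about [mu (S i a b) / v i]. *)
Lemma dyadic_cube_measure : exists (eta M : R) (v : int -> R),
  [/\ 0 < M, forall i, 0 < v i & forall i a b, (m%:Z %| i)%Z ->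
    [/\ (0 < mu (S i a b) < +oo)%E,
        (mu (S i a b) <=
           M%:E * mu (S i a b `&` (fst @^-1` center_base eta i a)))%E,
        (forall z, (lam (xsection (S i a b) z) <= (M / v i)%:E * mu (S i a b))%E) &
        forall z, center_base eta i a z ->
          (mu (S i a b) <= (M * v i)%:E * lam (xsection (S i a b) z))%E]].
Proof.
have [c [C [c0 C0 cC]]] := dyadic_cubes_ball DS.
(* Over the central box the squared base distance is at most [2 n (eta q)^2 = (c q)^2 / (2 n)],
   within the range [(c q)^2 / 2] of the lower fibre bound. *)
pose eta := c / (2 * n%:R).
have nR : 1 <= n%:R :> R by rewrite ler1n.
have eta0 : 0 < eta by rewrite divr_gt0// mulr_gt0// ltr0n.
(* [K] is the share of the base volume taken by the central box. *)
pose K := (2 * eta) ^+ (n + n).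
have K0 : 0 < K by rewrite exprn_gt0// mulr_gt0.
(* The first summand serves comparisons with the volume over the central box, the second those with
   a single central fibre. *)
pose M := 2 * C ^+ 2 / (c ^+ 2 * K) + 2 * C ^+ 2 / c ^+ 2.
have c20 : 0 < c ^+ 2 by rewrite exprn_gt0.
have C20 : 0 < C ^+ 2 by rewrite exprn_gt0.
have M1 : 2 * C ^+ 2 <= M * (c ^+ 2 * K).
  rewrite [M * _]mulrDl (divfK (mulf_neq0 (lt0r_neq0 c20) (lt0r_neq0 K0))).
  by rewrite lerDl mulr_ge0// ?divr_ge0 ?mulr_ge0// ltW.
have M2 : 2 * C ^+ 2 <= M * c ^+ 2.
  rewrite [M * _]mulrDl (divfK (lt0r_neq0 c20)) lerDr.
  by rewrite mulr_ge0// ?divr_ge0 ?mulr_ge0// ltW.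
have M0 : 0 < M.
  by rewrite addr_gt0// divr_gt0// ?mulr_gt0.
exists eta, M, (fun i => (2 ^ i) ^+ (n + n)); split => //.
  by move=> i; rewrite exprn_gt0// exprz_gt0.
move=> i a b mi; have [cS SC] := cC i a b mi.
set q : R := 2 ^ i; set v := q ^+ (n + n).
have q0 : 0 < q by rewrite exprz_gt0.
have v0 : 0 < v by rewrite exprn_gt0.
have mS := dyadic_cubes_measurable DS a b mi.
have Cq0 : 0 < C * q by rewrite mulr_gt0.
have cq0 : 0 < c * q by rewrite mulr_gt0.
have up z : (lam (xsection (S i a b) z) <= (2 * (C * q) ^+ 2)%:E)%E.
  exact: heis_ball_xsection_le SC.
have lo z : center_base eta i a z ->
    (((c * q) ^+ 2)%:E <= lam (xsection (S i a b) z))%E.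
  move=> za; apply: heis_ball_xsection_ge cS _ => //.
  apply: le_trans (center_base_dist2 b (ltW eta0) za) _.
  rewrite -/q !exprMn.
  rewrite [leLHS](_ : _ = (c ^+ 2 * q ^+ 2 / 2) / n%:R); last first.
    by field; rewrite pnatr_eq0 -lt0n.
  rewrite ler_pdivrMr ?(lt_le_trans ltr01)// ler_peMr// divr_ge0// mulr_ge0//.
    exact: ltW.
  by rewrite exprn_ge0// ltW.
have muS : (mu (S i a b) <= (2 * (C * q) ^+ 2 * v)%:E)%E.
  rewrite EFinM -(base_measure_cube (dyadic_corner R i a) q0) -dyadic_baseE.
  apply: heis_measure_le_xsection => //.
  - by rewrite dyadic_baseE; exact: measurable_base_cube.
  - by rewrite mulr_ge0// exprn_ge0// ltW.
  - by move=> x Sx; rewrite /= -(dyadic_cubes_proj DS a b mi); exists x.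
have mc : measurable (center_base eta i a) by exact: measurable_base_cube.
have mSc : measurable (S i a b `&` fst @^-1` center_base eta i a).
  apply: measurableI => //; rewrite -[X in measurable X]setTI.
  exact: measurable_fst.
have muSc : (((c * q) ^+ 2 * K * v)%:E <=
    mu (S i a b `&` fst @^-1` center_base eta i a))%E.
  rewrite (_ : _ * K * v = (c * q) ^+ 2 * (q * (2 * eta)) ^+ (n + n)); last first.
    by rewrite [(q * _) ^+ _]exprMn -/K -/v; ring.
  rewrite EFinM -(base_measure_cube (\row_k (2 ^ i * ((a.1 ord0 k)%:~R + 2^-1 - eta)),
     \row_k (2 ^ i * ((a.2 ord0 k)%:~R + 2^-1 - eta)))); last first.
    by rewrite mulr_gt0// mulr_gt0.
  apply: heis_measure_ge_xsection => //; first by rewrite exprn_ge0// ltW.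
  move=> z za; rewrite xsectionI (_ : xsection (fst @^-1` _) z = setT) ?setIT.
    exact: lo.
  apply/seteqP; split => // t _; rewrite /xsection/=; exact: mem_set.
have ScS : (mu (S i a b `&` fst @^-1` center_base eta i a) <= mu (S i a b))%E.
  by apply: le_measure; rewrite ?in_setE.
split.
- apply/andP; split; last by rewrite (le_lt_trans muS)// ltry.
  apply: lt_le_trans ScS; apply: lt_le_trans muSc.
  by rewrite lte_fin !mulr_gt0// exprn_gt0.
- apply: (le_trans muS).
  apply: le_trans (_ : M%:E * ((c * q) ^+ 2 * K * v)%:E <= _)%E; last first.
    by rewrite lee_wpmul2l// lee_fin ltW.
  rewrite -EFinM lee_fin.
  rewrite (_ : M * _ = M * (c ^+ 2 * K) * (q ^+ 2 * v)); last by ring.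
  rewrite (_ : 2 * _ * _ = 2 * C ^+ 2 * (q ^+ 2 * v)); last by ring.
  by rewrite ler_wpM2r// mulr_ge0// ltW// exprn_gt0.
- move=> z; apply: (le_trans (up z)).
  apply: le_trans (_ : (M / v)%:E * ((c * q) ^+ 2 * K * v)%:E <= _)%E; last first.
    rewrite lee_wpmul2l//; first by rewrite lee_fin divr_ge0// ltW.
    exact: le_trans muSc ScS.
  rewrite -EFinM lee_fin.
  rewrite (_ : M / v * _ = M * (c ^+ 2 * K) * q ^+ 2); last first.
    by field; rewrite gt_eqF.
  rewrite [leLHS](_ : _ = 2 * C ^+ 2 * q ^+ 2); last by ring.
  by rewrite ler_wpM2r// exprn_ge0// ltW.
- move=> z za; apply: (le_trans muS).
  apply: le_trans (_ : (M * v)%:E * ((c * q) ^+ 2)%:E <= _)%E; last first.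
    rewrite lee_wpmul2l//; first by rewrite lee_fin mulr_ge0// ltW.
    exact: lo.
  rewrite -EFinM lee_fin.
  rewrite (_ : M * _ * _ = M * c ^+ 2 * (q ^+ 2 * v)); last by ring.
  rewrite (_ : 2 * _ * _ = 2 * C ^+ 2 * (q ^+ 2 * v)); last by ring.
  by rewrite ler_wpM2r// mulr_ge0// ltW// exprn_gt0.
Qed.

End dyadic_cube_measure.

(** * The strong covering property for vertical rectangles *)

Section strong_cover.
Context (R : realType) (n m : nat).
Local Notation H := (heis R n).
Local Notation mu := (@heis_measure R n).
Local Notation lam := (@lebesgue_measure R).
Local Notation base := (@base_measure R n).
Context (S : int -> 'rV[int]_n * 'rV[int]_n -> int -> set H).
Hypothesis DS : dyadic_cubes m S.

Local Notation J := (int * ('rV[int]_n * 'rV[int]_n) * int)%type.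
Let cube (j : J) := S j.1.1 j.1.2 j.2.
Let grid : set J := [set j | (m%:Z %| j.1.1)%Z].

Lemma dyadic_cube_nested (P : set J) : P `<=` grid -> nested_family P cube.
Proof.
move=> Pg j k Pj Pk jk; have mj := Pg _ Pj; have mk := Pg _ Pk.
have [le_jk|/ltW le_kj] := leP j.1.1 k.1.1.
  by left; exact: (dyadic_cubes_nested DS mj mk le_jk jk).
by right; apply: (dyadic_cubes_nested DS mk mj le_kj); rewrite setIC.
Qed.

Lemma measurable_cube j : grid j -> measurable (cube j).
Proof. exact: dyadic_cubes_measurable. Qed.

Lemma trivIset_cube i a (P : set int) : (m%:Z %| i)%Z -> trivIset P (S i a).
Proof.
move=> mi b c _ _ bc.
have [_ tS _] := dyadic_cubes_partition DS mi.
by have [] := tS (a, b) (a, c) I I bc.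
Qed.

(** This is a vertical rectangle over the base cube [a] when [B] is a dyadic cube of larger scale
    containing one of these cubes. *)
Definition column i a (B : set H) := \bigcup_(c in [set c | S i a c `<=` B]) S i a c.

Lemma column_sub i a B : column i a B `<=` B.
Proof. by move=> x [c /= cB /cB]. Qed.

Lemma measurable_column i a B : (m%:Z %| i)%Z -> measurable (column i a B).
Proof.
move=> mi; apply: bigcup_countType_measurable => c _.
exact: (dyadic_cubes_measurable DS).
Qed.

(** The cube of scale [i] through a point over [z] has base [a], because base cubes are disjoint,
    and lies in the large cube by nesting. So rectangle and large cube share fibres, and the fibres
    of all rectangles over [z] belong to the nested family of fibres of cubes. *)
Lemma xsection_column i l a a' b' z : (m%:Z %| i)%Z -> (m%:Z %| l)%Z -> i <= l ->
  dyadic_base i a z ->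
  xsection (column i a (S l a' b')) z = xsection (S l a' b') z.
Proof.
move=> mi ml il za; apply/seteqP; split; first by apply: le_xsection; exact: column_sub.
move=> t; rewrite /xsection/= => /set_mem Bzt; apply/mem_set.
have [US _ _] := dyadic_cubes_partition DS mi.
have : [set: H] (z, t) by [].
rewrite -US => -[[a2 c] _ /= Szt].
have za2 : dyadic_base i a2 z.
  by rewrite -(dyadic_cubes_proj DS a2 c mi); exists (z, t).
rewrite -(dyadic_base_inj za za2) in Szt.
exists c => //=; apply: (dyadic_cubes_nested DS mi ml il).
by exists (z, t).
Qed.

Lemma measurable_fst_preimage (B : set ('rV[R]_n * 'rV[R]_n)) :
  measurable B -> measurable (fst @^-1` B : set H).
Proof.
by move=> mB; rewrite -[X in measurable X]setTI; exact: measurable_fst.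
Qed.

Hypothesis n0 : (0 < n)%N.

Lemma dyadic_strong_cover : exists2 K : R, 0 <= K & forall A, measurable A ->
  exists U, [/\ measurable U, (mu U <= K%:E * mu A)%E &
    forall i l E, (m%:Z %| i)%Z -> (m%:Z %| l)%Z -> i <= l ->
      vertical_rect S i l E -> (mu E < 2%:E * mu (E `&` A))%E -> E `<=` U].
Proof.
have [eta [M [v [M0 v0 cubeP]]]] := dyadic_cube_measure n0 DS.
(* The loss in a fibre: 4 from [muE1], and a factor [M] for each passage between fibre length and
   volume. *)
pose M4 := 4 * (M * M).
have M40 : 0 <= M4 by rewrite !mulr_ge0// ltW.
(* The three covering constants: [M] for [P3], [M4] for [A2] and 4 for [A1]. *)
exists (M * (M4 * 4)) => [|A mA]; first by rewrite !mulr_ge0// ltW.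
pose P1 : set J := [set j | grid j /\ (mu (cube j) <= 4%:E * mu (A `&` cube j))%E].
have P1g : P1 `<=` grid by move=> j [].
pose A1 := \bigcup_(j in P1) cube j.
have mA1 : measurable A1.
  by apply: bigcup_countType_measurable => j /P1g; exact: measurable_cube.
have muA1 : (mu A1 <= 4%:E * mu A)%E.
  apply: nested_cover => //.
  - by move=> j /P1g; exact: measurable_cube.
  - exact: dyadic_cube_nested.
  - by move=> j [].
(* The base points over which [A1] fills a fixed proportion of the fibre of the cube [j];
   measurability of this set makes [A2] measurable. *)
pose good (j : J) := [set z | (lam (xsection (cube j) z) <=
    M4%:E * lam (xsection A1 z `&` xsection (cube j) z))%E].
have mgood j : grid j -> measurable (good j).
  move=> /measurable_cube mj; rewrite -[X in measurable X]setTI.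
  apply: measurable_lee => //; first exact: measurable_fun_lam_xsection.
  apply: measurable_funeM; under eq_fun do rewrite -xsectionI.
  by apply: measurable_fun_lam_xsection; exact: measurableI.
pose A2 := \bigcup_(j in grid) (cube j `&` (fst @^-1` good j)).
have mA2 : measurable A2.
  apply: bigcup_countType_measurable => j gj; apply: measurableI.
    exact: measurable_cube.
  by apply: measurable_fst_preimage; exact: mgood.
(* The one-dimensional covering in each fibre is integrated over [z]; fibres over one [z] are nested
   because the cubes are. *)
have muA2 : (mu A2 <= M4%:E * mu A1)%E.
  rewrite !heis_measure_xsection -ge0_integralZl//; last first.
    exact: measurable_fun_lam_xsection.
  apply: ge0_le_integral => //.
  - exact: measurable_fun_lam_xsection.
  - by apply: measurable_funeM; exact: measurable_fun_lam_xsection.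
  - move=> z _.
    rewrite (_ : xsection A2 z = \bigcup_(j in [set j | grid j /\ good j z])
        xsection (cube j) z); last first.
      apply/seteqP; split => t; rewrite /xsection/=.
        by move=> /set_mem[j gj [/= ? ?]]; exists j => //=; exact: mem_set.
      by move=> [j [gj jz] /set_mem ?]; apply/mem_set; exists j.
    apply: nested_cover => //.
    + exact: measurable_xsection.
    + by move=> j [gj _]; apply: measurable_xsection; exact: measurable_cube.
    + move=> j k [gj _] [gk _] [t []]; rewrite /xsection/= => /set_mem jt /set_mem kt.
      have [jk|kj] := @dyadic_cube_nested grid (@subset_refl _ _) j k gj gk
          (ex_intro _ (z, t) (conj jt kt)).
        by left; exact: le_xsection.
      by right; exact: le_xsection.
    + by move=> j [].
pose P3 : set J := [set j | grid j /\ (mu (cube j) <= M%:E * mu (A2 `&` cube j))%E].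
have P3g : P3 `<=` grid by move=> j [].
exists (\bigcup_(j in P3) cube j); split.
- by apply: bigcup_countType_measurable => j /P3g; exact: measurable_cube.
- apply: (@le_trans _ _ (M%:E * mu A2)%E).
    apply: nested_cover => //; first exact: ltW.
    + by move=> j /P3g; exact: measurable_cube.
    + exact: dyadic_cube_nested.
    + by move=> j [].
  rewrite (_ : (M * (M4 * 4))%:E = M%:E * (M4%:E * 4%:E))%E; last by rewrite -!EFinM.
  rewrite -!muleA lee_wpmul2l ?lee_fin ?(ltW M0)//.
  by rewrite (le_trans muA2)// lee_wpmul2l.
move=> i l E mi ml il [a [b [a' [b' [_ ->]]]]].
set B := S l a' b'; rewrite -/(column i a B) => EA.
have mS c := dyadic_cubes_measurable DS a c mi.
have mE := measurable_column a B mi.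
have mB : measurable B := dyadic_cubes_measurable DS a' b' ml.
have fE : mu (column i a B) \is a fin_num.
  rewrite ge0_fin_numE//; have [/andP[_ Boo] _ _ _] := cubeP l a' b' ml.
  apply: le_lt_trans Boo; apply: le_measure; rewrite ?in_setE//.
  exact: column_sub.
pose G := [set c | S i a c `<=` B].
(* The cubes of the rectangle are split according to whether they were selected for [A1]. *)
pose E1 := \bigcup_(c in G `&` [set c | P1 (i, a, c)]) S i a c.
pose E2 := \bigcup_(c in G `\` [set c | P1 (i, a, c)]) S i a c.
have mE1 : measurable E1 by apply: bigcup_countType_measurable => c _; exact: mS.
have mE2 : measurable E2 by apply: bigcup_countType_measurable => c _; exact: mS.
have E1E : E1 `<=` column i a B by move=> x [c [Gc _] Sx]; exists c.
have E2E : E2 `<=` column i a B by move=> x [c [Gc _] Sx]; exists c.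
have fE1 : mu E1 \is a fin_num.
  rewrite ge0_fin_numE//; move: fE; rewrite ge0_fin_numE//; apply: le_lt_trans.
  by apply: le_measure; rewrite ?in_setE.
(* A cube that was not selected has less than a quarter of its measure in [A]. *)
have muE2 : (mu (A `&` E2) <= (4^-1)%:E * mu (column i a B))%E.
  apply: (@le_trans _ _ ((4^-1)%:E * mu E2)%E); last first.
    by rewrite lee_wpmul2l//; apply: le_measure; rewrite ?in_setE.
  rewrite setI_bigcupr; apply: le_measure_bigcup => //.
  - by move=> c _; exact: measurableI.
  - exact: trivIset_cube.
  - move=> c [_ nP1]; rewrite leNgt; apply/negP => hc; apply: nP1; split => //=.
    have [/andP[_ Soo] _ _ _] := cubeP i a c mi.
    have fS : mu (S i a c) \is a fin_num by rewrite ge0_fin_numE.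
    have fAS : mu (A `&` S i a c) \is a fin_num.
      rewrite ge0_fin_numE//; apply: le_lt_trans Soo.
      by apply: le_measure; rewrite ?in_setE//; exact: measurableI.
    move: hc; rewrite /cube/= -(fineK fS) -(fineK fAS) -!EFinM lte_fin lee_fin.
    lra.
(* With [E] the rectangle, [|E| < 2 |E1| + |E| / 2]. *)
have muE1 : (mu (column i a B) <= 4%:E * mu E1)%E.
  have : (mu (column i a B `&` A) <= mu E1 + mu (A `&` E2))%E.
    apply: (@le_trans _ _ (mu (E1 `|` (A `&` E2)))).
      apply: le_measure; rewrite ?in_setE.
      + exact: measurableI.
      + by apply: measurableU => //; exact: measurableI.
      + move=> x [[c Gc Sx] Ax]; have [Pc|nPc] := pselect (P1 (i, a, c)).
          by left; exists c.
        by right; split => //; exists c.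
    by apply: measureU2 => //; exact: measurableI.
  move=> EAle; have {EAle} : (mu (column i a B) <
      2%:E * (mu E1 + (4^-1)%:E * mu (column i a B)))%E.
    apply: (lt_le_trans EA); rewrite lee_wpmul2l//.
    by rewrite (le_trans EAle)// leeD2l.
  rewrite -(fineK fE) -(fineK fE1) -!EFinM.
  rewrite lte_fin lee_fin; lra.
(* From the fibre to the volume, from the rectangle to [E1], and back to the fibre, with factors
   [M / v i], 4 and [M * v i]. *)
have lamE z : center_base eta i a z ->
    (lam (xsection (column i a B) z) <= M4%:E * lam (xsection E1 z))%E.
  move=> za.
  have xsec (P : set int) : xsection (\bigcup_(c in P) S i a c) z =
      \bigcup_(c in P) xsection (S i a c) z.
    apply/seteqP; split => t; rewrite /xsection/=.
      by move=> /set_mem[c Pc ?]; exists c => //=; exact: mem_set.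
    by move=> [c Pc /set_mem ?]; apply/mem_set; exists c.
  apply: (@le_trans _ _ ((M / v i)%:E * mu (column i a B))%E).
    rewrite xsec; apply: le_measure_bigcup.
    - by rewrite divr_ge0// ltW.
    - by move=> c _; exact: measurable_xsection.
    - by move=> c _; exact: mS.
    - exact: trivIset_cube.
    - by move=> c _; have [_ _ + _] := cubeP i a c mi; exact.
  have muE1z : (mu E1 <= (M * v i)%:E * lam (xsection E1 z))%E.
    rewrite xsec; apply: le_measure_bigcup.
    - by rewrite mulr_ge0// ltW.
    - by move=> c _; exact: mS.
    - by move=> c _; exact: measurable_xsection.
    - move=> c1 c2 _ _ [t []]; rewrite /xsection/= => /set_mem c1t /set_mem c2t.
      have tS := @trivIset_cube i a setT mi.
      by apply: tS => //; exists (z, t).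
    - by move=> c _; have [_ _ _ +] := cubeP i a c mi; exact.
  apply: (@le_trans _ _ ((M / v i)%:E * (4%:E * ((M * v i)%:E * lam (xsection E1 z))))%E).
    rewrite lee_wpmul2l//; first by rewrite lee_fin divr_ge0// ltW.
    by rewrite (le_trans muE1)// lee_wpmul2l.
  rewrite !muleA -!EFinM (_ : M / v i * 4 * (M * v i) = M4)//.
  by rewrite /M4; field; rewrite gt_eqF.
(* The large cube is the witness: its fibre over [z] is the fibre of the rectangle. *)
have A2c c : G c -> S i a c `&` fst @^-1` center_base eta i a `<=` A2.
  move=> Gc [z t] [Szt /= za]; exists (l, a', b') => //; split; first exact: Gc.
  rewrite /good/= /cube/= -/B.
  have zb : dyadic_base i a z.
    by rewrite -(dyadic_cubes_proj DS a c mi); exists (z, t).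
  rewrite -[xsection B z](xsection_column a' b' mi ml il zb).
  apply: (le_trans (lamE z za)); rewrite lee_wpmul2l//.
  apply: le_measure; rewrite ?in_setE; try exact: measurable_xsection.
    by apply: measurableI; exact: measurable_xsection.
  rewrite -xsectionI; apply: le_xsection => x [c' [Gc' Pc'] Sx]; split.
    by exists (i, a, c').
  by exists c'.
(* Each cube of the rectangle has at least the proportion [1 / M] of its measure over the central
   box, hence in [A2]. *)
move=> x [c Gc Sx]; exists (i, a, c) => //; split => //=.
have [_ Sc _ _] := cubeP i a c mi; apply: (le_trans Sc).
rewrite lee_wpmul2l ?lee_fin ?(ltW M0)//.
apply: le_measure; rewrite ?in_setE.
- apply: measurableI => //; apply: measurable_fst_preimage.
  exact: measurable_base_cube.
- by apply: measurableI => //; exact: measurable_cube.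
- by move=> y Sy; split; [exact: A2c Sy|case: Sy].
Qed.

End strong_cover.

(** * The indexed family of rectangles *)

Section rectangles.
Context (R : realType) (n m N : nat) (kappa : R).
Local Notation H := (heis R n).
Local Notation mu := (@heis_measure R n).
Context (S : int -> 'rV[int]_n * 'rV[int]_n -> int -> set H).
Hypotheses (n0 : (0 < n)%N) (m0 : (0 < m)%N) (kappa0 : 0 < kappa).
Hypothesis DS : dyadic_cubes m S.
Local Notation I := (rect_index m S kappa N).
Local Notation E := (rect_set m S kappa N).
Local Notation level j := (scale m (- (kappa * (j%:~R + N%:R)))).

Lemma dvd_scale (r : R) : (m%:Z %| scale m r)%Z.
Proof. exact: dvdz_mulr. Qed.

Lemma level_le (j k : int) : k <= j -> level j <= level k.
Proof.
move=> kj; rewrite /scale ler_wpM2l//; apply: le_floor.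
by rewrite ler_pM2r ?invr_gt0 ?ltr0n// lerN2 ler_pM2l// lerD2r ler_int.
Qed.

Lemma rect_setP (r : I) : exists j k : int, k <= j /\
  vertical_rect S (level j) (level k) (E r).
Proof.
have [kj rF] := set_mem (valP r).
by exists (\val r).1.1, (\val r).1.2.
Qed.

(** An indexed rectangle is determined by finitely many integers: its two indices, its base and its
    enclosing cube. *)
Lemma countable_rect_index : countable [set: I].
Proof.
pose J := (int * int * ('rV[int]_n * 'rV[int]_n) * ('rV[int]_n * 'rV[int]_n) * int)%type.
pose f (x : J) : int * int * set H :=
  (x.1.1.1, column S (level x.1.1.1.1) x.1.1.2 (S (level x.1.1.1.2) x.1.2 x.2)).
have /choice[h hP] : forall r : I, exists x : J, f x = \val r.
  move=> r; have := set_mem (valP r).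
  case: (\val r) => [[j k] A] [/= kj [a [b [a' [b' [_ ->]]]]]].
  by exists ((j, k), a, a', b').
apply/countable_injP; exists (fun r : I => choice.pickle (h r)) => r s _ _.
move=> /(pcan_inj choice.pickleK) rs.
by apply: val_inj; rewrite -!hP rs.
Qed.

Lemma measurable_rect_set (r : I) : measurable (E r).
Proof.
have [j [k [kj [a [b [a' [b' [_ ->]]]]]]]] := rect_setP r.
exact: (measurable_column DS _ _ (dvd_scale _)).
Qed.

Lemma rect_set_measure (r : I) : (0 < mu (E r) < +oo)%E.
Proof.
have mE := measurable_rect_set r.
have [j [k [kj [a [b [a' [b' [Sab Er]]]]]]]] := rect_setP r.
have [eta [M [v [_ _ cubeP]]]] := dyadic_cube_measure n0 DS.
have [/andP[S0 _] _ _ _] := cubeP _ a b (dvd_scale (- (kappa * (j%:~R + N%:R)))).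
have [/andP[_ Soo] _ _ _] := cubeP _ a' b' (dvd_scale (- (kappa * (k%:~R + N%:R)))).
apply/andP; split.
- apply: (lt_le_trans S0); apply: le_measure; rewrite ?in_setE//.
    exact: (dyadic_cubes_measurable DS _ _ (dvd_scale _)).
  by rewrite Er => x Sx; exists b.
- apply: le_lt_trans Soo; apply: le_measure; rewrite ?in_setE//.
    exact: (dyadic_cubes_measurable DS _ _ (dvd_scale _)).
  by rewrite Er; exact: column_sub.
Qed.

(** Outer regularity with excess [mu A] accounts for the 1 added to [K]. The excess must be
    positive, so a null [A] is treated apart: no rectangle then qualifies and the empty set will
    do. *)
Lemma rect_strong_cover : exists2 K : R, 0 <= K & forall A, measurable A ->
  (mu A < +oo)%E -> exists U, [/\ open U, (mu U <= K%:E * mu A)%E &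
    forall r : I, (mu (E r) < 2%:E * mu (E r `&` A))%E -> E r `<=` U].
Proof.
have [K K0 cover] := dyadic_strong_cover DS n0.
exists (K + 1); first by rewrite addr_ge0.
move=> A mA Aoo; have [A0|A0] := eqVneq (mu A) 0%E.
  exists set0; split; [exact: open0|by rewrite measure0 A0 mule0|].
  move=> r; rewrite (_ : mu (E r `&` A) = 0%E) ?mule0 ?ltNge ?measure_ge0//.
  apply/eqP; rewrite -measure_le0 -A0; apply: le_measure; rewrite ?in_setE//.
  by apply: measurableI => //; exact: measurable_rect_set.
have fA : mu A \is a fin_num by rewrite ge0_fin_numE.
have fA0 : 0 < fine (mu A).
  by rewrite fine_gt0// Aoo andbT lt0e A0 measure_ge0.
have [V [mV VA coverV]] := cover A mA.
have [U [oU VU muU]] := heis_outer_regular mV fA0.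
exists U; split => //.
  rewrite (le_trans muU)// EFinD ge0_muleDl ?lee_fin// mul1e fineK//.
  by rewrite leeD2r.
move=> r rA; apply: subset_trans VU.
have [j [k [kj rE]]] := rect_setP r.
exact: (coverV _ _ _ (dvd_scale _) (dvd_scale _) (level_le kj) rE rA).
Qed.

End rectangles.

(** * Finite duality *)

Lemma geometric_level_sum (R : realFieldType) (q y : R) (v : nat -> R) (J : nat) :
  1 < q -> 0 <= y -> (forall j, 0 <= v j) -> (forall j, v j.+1 = q * v j) ->
  (1 - q^-1) * (\sum_(j < J) v j * (v j < y)%R%:R) <= y.
Proof.
move=> q1 y0 v0 vS; have q0 : 0 < q by exact: lt_trans q1.
(* The extra bound by [v J / q] is what carries the induction while the terms stay below [y]. *)
suff : (1 - q^-1) * (\sum_(j < J) v j * (v j < y)%R%:R) <= Num.min (v J / q) y.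
  by rewrite le_min => /andP[].
elim: J => [|J IH].
  by rewrite big_ord0 mulr0 le_min y0 divr_ge0// ltW.
have vJ : v J / q <= v J by rewrite ler_pdivrMr// ler_peMr// ltW.
rewrite big_ord_recr/= mulrDr vS mulrAC mulfV ?gt_eqF// mul1r.
move: IH; rewrite le_min => /andP[IHv IHy].
have [vy|yv] := ltP (v J) y; last by rewrite mulr0 mulr0 addr0.
rewrite mulr1; have -> : (1 - q^-1) * v J = v J - v J / q by ring.
lra.
Qed.

Lemma integral_weighted_indic d (T : measurableType d) (R : realType)
    (mu : {measure set T -> \bar R}) (I : Type) (s : seq I) (c : I -> R)
    (F : I -> set T) :
  (forall r, 0 <= c r) -> (forall r, measurable (F r)) ->
  (\int[mu]_x (\sum_(r <- s) c r * \1_(F r) x)%:E =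
   \sum_(r <- s) (c r)%:E * mu (F r))%E.
Proof.
move=> c0 mF; under eq_integral do rewrite -sumEFin.
rewrite ge0_integral_sum//; last 2 first.
- by move=> r; apply/measurable_EFinP/measurable_funM => //; exact: measurable_indic.
- by move=> r x _; rewrite lee_fin mulr_ge0// indicE ler0n.
apply: eq_bigr => r _; under eq_integral do rewrite EFinM.
rewrite ge0_integralZl_EFin//; last exact/measurable_EFinP/measurable_indic.
by rewrite integral_indic// setIT.
Qed.

Section finite_duality.
Context d (T : measurableType d) (R : realType) (mu : {measure set T -> \bar R}).
Context (I : choiceType) (E : I -> set T) (w : I -> R).
Hypotheses (mE : forall r, measurable (E r)) (muE : forall r, mu (E r) = (w r)%:E).
Hypothesis w0 : forall r, 0 < w r.

(** The square of the square function, for a finite family and real coefficients. *)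
Definition square_sum (s : seq I) (a : I -> R) (x : T) : R :=
  \sum_(r <- s) a r ^+ 2 / w r * \1_(E r) x.

Lemma square_sum_ge0 s a x : 0 <= square_sum s a x.
Proof.
apply: sumr_ge0 => r _.
by rewrite mulr_ge0 ?indicE ?ler0n// divr_ge0 ?sqr_ge0// ltW.
Qed.

Lemma measurable_square_sum s a : measurable_fun setT (square_sum s a).
Proof.
apply: measurable_sum => r.
by apply: measurable_funM => //; exact: measurable_indic.
Qed.

Lemma integral_square_sum s a :
  (\int[mu]_x (square_sum s a x)%:E = (\sum_(r <- s) a r ^+ 2)%:E)%E.
Proof.
rewrite integral_weighted_indic//; last first.
  by move=> r; rewrite divr_ge0 ?sqr_ge0// ltW.
rewrite -sumEFin; apply: eq_bigr => r _; rewrite muE -EFinM divfK//.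
by rewrite gt_eqF.
Qed.

(** The square sum is integrated over [U] outside [V]. There it is at most [u], while each [E r]
    keeps at least half of its measure, so the integral is at least half of the sum of squares. *)
Lemma level_block_square_le (s : seq I) (a : I -> R) (U V : set T) (u M : R) :
  0 <= u -> measurable U -> measurable V -> (mu U <= M%:E)%E ->
  (forall r, r \in s -> E r `<=` U) ->
  (forall r, r \in s -> (2%:E * mu (E r `&` V) <= (w r)%:E)%E) ->
  (forall x, ~ V x -> square_sum s a x <= u) ->
  \sum_(r <- s) a r ^+ 2 <= 2 * u * M.
Proof.
move=> u0 mU mV UM sU sV su.
have mEV r : measurable (E r `\` V) by exact: measurableD.
have wE r : r \in s -> ((w r / 2)%:E <= mu (E r `\` V))%E.
  move=> rs; have := muE r; rewrite (measureDI mu (mE r) mV) => wr.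
  have fV : mu (E r `&` V) \is a fin_num.
    rewrite ge0_fin_numE//; apply: (@le_lt_trans _ _ (mu (E r))).
      by apply: le_measure; rewrite ?in_setE//; exact: measurableI.
    by rewrite muE ltry.
  have fD : mu (E r `\` V) \is a fin_num.
    rewrite ge0_fin_numE//; apply: (@le_lt_trans _ _ (mu (E r))).
      by apply: le_measure; rewrite ?in_setE.
    by rewrite muE ltry.
  move: wr => /(congr1 fine); rewrite fineD//= => wr.
  have := sV r rs; rewrite -(fineK fV) -EFinM lee_fin -(fineK fD) lee_fin; lra.
rewrite -lee_fin.
apply: (@le_trans _ _ (2%:E * \sum_(r <- s) (a r ^+ 2 / w r)%:E * mu (E r `\` V))%E).
  rewrite -sumEFin ge0_sume_distrr; last first.
    by move=> r _; rewrite mule_ge0// lee_fin divr_ge0 ?sqr_ge0// ltW.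
  rewrite big_seq [leRHS]big_seq; apply: lee_sum => r rs.
  apply: (@le_trans _ _ (2%:E * ((a r ^+ 2 / w r)%:E * (w r / 2)%:E))%E).
    rewrite -!EFinM lee_fin [leRHS](_ : _ = a r ^+ 2)//.
    by field; rewrite gt_eqF.
  rewrite lee_wpmul2l// lee_wpmul2l ?wE// lee_fin divr_ge0 ?sqr_ge0// ltW//.
rewrite -mulrA EFinM lee_wpmul2l//.
rewrite -integral_weighted_indic//; last first.
  by move=> r; rewrite divr_ge0 ?sqr_ge0// ltW.
apply: (@le_trans _ _ (u%:E * mu U)%E); last first.
  by rewrite EFinM lee_wpmul2l// lee_fin.
rewrite -(setIT U) -integral_indic// -ge0_integralZl_EFin//; last first.
  exact/measurable_EFinP/measurable_indic.
apply: ge0_le_integral => //.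
- move=> x _; rewrite lee_fin; apply: sumr_ge0 => r _.
  by rewrite mulr_ge0 ?indicE ?ler0n// divr_ge0 ?sqr_ge0// ltW.
- apply/measurable_EFinP; apply: measurable_sum => r.
  by apply: measurable_funM => //; exact: measurable_indic.
- apply/measurable_EFinP/measurable_funM => //; exact: measurable_indic.
- move=> x _; rewrite -EFinM lee_fin.
  have [Vx|nVx] := pselect (V x).
    rewrite big1 => [|r _]; first by rewrite mulr_ge0// indicE ler0n.
    by rewrite indicE memNset ?mulr0// => -[].
  have [Ux|nUx] := pselect (U x).
    rewrite [X in _ <= _ * X]indicE mem_set// mulr1.
    apply: le_trans (su x nVx); apply: ler_sum => r _.
    rewrite ler_wpM2l//; first by rewrite divr_ge0 ?sqr_ge0// ltW.
    rewrite !indicE ler_nat; case: (boolP (x \in E r `\` V)) => // /set_mem[Ex _].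
    by rewrite mem_set.
  rewrite [X in _ <= _ * X]indicE memNset// mulr0.
  rewrite big_seq big1// => r rs; rewrite indicE memNset ?mulr0// => -[Ex _].
  by apply: nUx; exact: (sU r rs).
Qed.

(** Cauchy-Schwarz in additive form, with a weight [l] left free to balance the two sums. *)
Lemma am_gm_sum (s : seq I) (a b : I -> R) (l : R) : 0 < l ->
  \sum_(r <- s) a r * b r <=
    (l * (\sum_(r <- s) a r ^+ 2) + l^-1 * (\sum_(r <- s) b r ^+ 2)) / 2.
Proof.
move=> l0; rewrite !mulr_sumr -big_split/= mulr_suml; apply: ler_sum => r _.
have : 0 <= l * (a r - l^-1 * b r) ^+ 2 by rewrite mulr_ge0 ?sqr_ge0// ltW.
rewrite (_ : l * _ = l * a r ^+ 2 + l^-1 * b r ^+ 2 - 2 * (a r * b r)); first by lra.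
by field; rewrite gt_eqF.
Qed.

Lemma powR_sqr_half (u p : R) : 0 <= u -> (u ^+ 2) `^ (p / 2) = u `^ p.
Proof.
by move=> u0; rewrite -powR_mulrn// -powRrM mulrCA divff ?mulr1// pnatr_eq0.
Qed.

Lemma ltr_powRE (x y q : R) : 0 < q -> 0 <= x -> 0 <= y ->
  (x `^ q < y `^ q) = (x < y).
Proof.
move=> q0 x0 y0; apply/idP/idP.
  rewrite !ltNge; apply: contra => yx.
  by apply: ge0_ler_powR; rewrite ?nnegrE// ltW.
by apply: gt0_ltr_powR; rewrite ?nnegrE.
Qed.

(** The first factor sums a geometric series over the levels. The second bounds one block: [8 * K]
    comes from the coefficients [a], the power of [K] from [b]. *)
Definition duality_const (K p : R) : R :=
  (1 - (2 `^ p)^-1)^-1 * ((8 * K + K `^ (2 / p - 1)) / 2).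

(** * Level sets of the square function *)

Section levels.
Context (s : seq I) (a : I -> R) (p theta : R).
Hypotheses (p0 : 0 < p) (theta0 : 0 < theta).
Hypothesis (int_le1 : (\int[mu]_x (square_sum s a x `^ (p / 2))%:E <= 1)%E).

Definition level (j : nat) : R := theta * 2 ^+ j.
Definition level_set (j : nat) : set T := [set x | level j ^+ 2 < square_sum s a x].

Lemma level_gt0 j : 0 < level j.
Proof. by rewrite mulr_gt0// exprn_gt0. Qed.

Lemma measurable_level_set j : measurable (level_set j).
Proof.
rewrite (_ : level_set j = square_sum s a @^-1` [set` `]level j ^+ 2, +oo[]).
  rewrite -[X in measurable X]setTI; apply: measurable_square_sum => //.
by apply/seteqP; split => x; rewrite /level_set/= in_itv/= andbT.
Qed.

Lemma mem_level_set j x :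
  (x \in level_set j) = (level j `^ p < square_sum s a x `^ (p / 2)).
Proof.
rewrite -(powR_sqr_half _ (ltW (level_gt0 j))) ltr_powRE ?divr_gt0//.
- by apply/idP/idP => [/set_mem|?]; [|exact/mem_set].
- by rewrite sqr_ge0.
- exact: square_sum_ge0.
Qed.

Lemma measurable_square_sum_powR q :
  measurable_fun setT (fun x => (square_sum s a x `^ q)%:E).
Proof.
apply/measurable_EFinP.
by apply: (measurableT_comp (measurable_powR _)); exact: measurable_square_sum.
Qed.

Lemma level_set_chebyshev j : ((level j `^ p)%:E * mu (level_set j) <= 1)%E.
Proof.
apply: le_trans int_le1.
have mj := measurable_level_set j.
rewrite -(setIT (level_set j)) -integral_indic// -ge0_integralZl_EFin//; last 2 first.
- exact/measurable_EFinP/measurable_indic.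
- exact: powR_ge0.
apply: ge0_le_integral => //.
- by move=> x _; rewrite -EFinM lee_fin mulr_ge0 ?powR_ge0// indicE ler0n.
- by apply/measurable_EFinP/measurable_funM => //; exact: measurable_indic.
- exact: measurable_square_sum_powR.
- move=> x _; rewrite -EFinM lee_fin indicE mem_level_set.
  by case: ltP => [/ltW|]; rewrite ?mulr1 ?mulr0 ?powR_ge0.
Qed.

Lemma level_set_fin_num j : mu (level_set j) \is a fin_num.
Proof.
have := level_set_chebyshev j; have vj : 0 < level j `^ p by rewrite powR_gt0// level_gt0.
rewrite ge0_fin_numE// ltey; apply: contraTneq => ->.
by rewrite gt0_muley ?lte_fin// -ltNge ltry.
Qed.

(** Sum and integral are exchanged; at each point the levels below the square function contribute a
    geometric series whose ratio is 2 to the power [p]. *)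
Lemma level_set_sum J :
  \sum_(j < J) level j `^ p * fine (mu (level_set j)) <= (1 - (2 `^ p)^-1)^-1.
Proof.
have q1 : 1 < 2 `^ p :> R.
  by have := @ltr_powRE 1 2 p p0; rewrite powR1 => ->; rewrite ?ltr1n.
have c0 : 0 < 1 - (2 `^ p)^-1 :> R.
  by rewrite subr_gt0 invf_lt1// (lt_trans _ q1).
rewrite -lee_fin -sumEFin.
under eq_bigr do rewrite EFinM fineK ?level_set_fin_num//.
rewrite -integral_weighted_indic//; last 2 first.
- by move=> j; exact: powR_ge0.
- by move=> j; exact: measurable_level_set.
apply: (@le_trans _ _ (((1 - (2 `^ p)^-1)^-1)%:E *
    \int[mu]_x (square_sum s a x `^ (p / 2))%:E)%E); last first.
  by rewrite -[leRHS]mule1 lee_wpmul2l// lee_fin invr_ge0 ltW.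
rewrite -ge0_integralZl_EFin//; last 3 first.
- by move=> x _; rewrite lee_fin powR_ge0.
- exact: measurable_square_sum_powR.
- by rewrite invr_ge0 ltW.
apply: ge0_le_integral => //.
- move=> x _; rewrite lee_fin sumr_ge0// => j _.
  by rewrite mulr_ge0 ?powR_ge0// indicE ler0n.
- apply/measurable_EFinP; apply: measurable_sum => j.
  apply: measurable_funM => //; apply: measurable_indic; exact: measurable_level_set.
- apply: measurable_funeM; exact: measurable_square_sum_powR.
- move=> x _; rewrite -EFinM lee_fin -ler_pdivrMl ?invr_gt0// invrK.
  under eq_bigr do rewrite indicE mem_level_set.
  apply: (@geometric_level_sum _ (2 `^ p) _ (fun j => level j `^ p)) => //.
  + exact: powR_ge0.
  + by move=> j; exact: powR_ge0.
  + move=> j; rewrite -powRM ?ler0n ?(ltW (level_gt0 j))//; congr (_ `^ _).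
    by rewrite /level exprS mulrCA.
Qed.

End levels.

Lemma square_sum_filter_le (P : pred I) s a x :
  square_sum [seq r <- s | P r] a x <= square_sum s a x.
Proof.
rewrite /square_sum big_filter [leLHS]big_mkcond; apply: ler_sum => r _.
case: ifP => // _.
by rewrite mulr_ge0 ?indicE ?ler0n// divr_ge0 ?sqr_ge0// ltW.
Qed.

Lemma square_sum_le s a x : square_sum s a x <= \sum_(r <- s) a r ^+ 2 / w r.
Proof.
apply: ler_sum => r _; by rewrite ler_piMr// divr_ge0 ?sqr_ge0// ltW.
Qed.

Lemma square_sum_ge s a r x : r \in s -> E r x -> a r ^+ 2 / w r <= square_sum s a x.
Proof.
move=> rs Ex; rewrite /square_sum (perm_big _ (perm_to_rem rs))/= big_cons.
rewrite indicE mem_set// mulr1 lerDl; exact: square_sum_ge0.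
Qed.

(** The family is finite, so some bottom level lies below the square function on every rectangle
    with a positive coefficient. *)
Lemma exists_low_level (s : seq I) (a : I -> R) : exists2 theta : R, 0 < theta &
  forall r, r \in s -> 0 < a r -> theta ^+ 2 < a r ^+ 2 / w r.
Proof.
elim: s => [|r s [t t0 ts]]; first by exists 1.
have [ar|ar] := ltP 0 (a r); last first.
  exists t => // q; rewrite inE => /predU1P[->|/ts//].
  by rewrite ltNge ar.
pose c := a r ^+ 2 / w r; have c0 : 0 < c by rewrite divr_gt0// exprn_gt0.
pose t' := Num.min t (Num.sqrt c / 2).
have t'0 : 0 < t' by rewrite lt_min t0/= divr_gt0// sqrtr_gt0.
exists t' => // q; rewrite inE => /predU1P[-> _|qs aq].
  rewrite -/c; apply: (@le_lt_trans _ _ ((Num.sqrt c / 2) ^+ 2)).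
    rewrite ler_pXn2r ?nnegrE ?(ltW t'0) ?divr_ge0 ?sqrtr_ge0//.
    by rewrite /t' ge_min lexx orbT.
  rewrite expr_div_n sqr_sqrtr ?(ltW c0)// ltr_pdivrMr ?exprn_gt0//.
  by rewrite ltr_pMr// -natrX ltr1n.
apply: le_lt_trans (ts q qs aq); rewrite ler_pXn2r ?nnegrE ?(ltW t'0) ?(ltW t0)//.
by rewrite /t' ge_min lexx.
Qed.

(** * The pairing bound for finite sums *)

Section finite_pairing.
Context (Us : set (set T)) (K p : R).
Hypotheses (K0 : 0 <= K) (p0 : 0 < p) (p1 : p <= 1).
Hypothesis measurable_Us : forall U, Us U -> measurable U.
Hypothesis cover : forall A, measurable A -> (mu A < +oo)%E ->
  exists U, [/\ Us U, (mu U <= K%:E * mu A)%E &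
    forall r, (mu (E r) < 2%:E * mu (E r `&` A))%E -> E r `<=` U].
Context (s : seq I) (a b : I -> R) (N : R).
Hypotheses (a0 : forall r, 0 <= a r) (b0 : forall r, 0 <= b r) (N0 : 0 < N).
Hypothesis int_le1 : (\int[mu]_x (square_sum s a x `^ (p / 2))%:E <= 1)%E.
Hypothesis b_le : forall U, Us U -> (mu U < +oo)%E ->
  \sum_(r <- s | `[< E r `<=` U >]) b r ^+ 2 <= N ^+ 2 * fine (mu U) `^ (2 / p - 1).

(** [cover] yields one [U] of measure at most [K * om] that contains the whole block. The sum of the
    [a r ^+ 2] is then controlled through the next level set, that of the [b r ^+ 2] by the
    hypothesis on [U]. *)
Lemma level_block_le (theta : R) (j : nat) (P : pred I) : 0 < theta ->
  let lset := level_set s a theta in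
  (forall r, P r -> (mu (E r) < 2%:E * mu (E r `&` lset j))%E) ->
  (forall r, P r -> (2%:E * mu (E r `&` lset j.+1) <= mu (E r))%E) ->
  \sum_(r <- s | P r) a r * b r <= (8 * K + K `^ (2 / p - 1)) / 2 * N *
     (level theta j `^ p * fine (mu (lset j))).
Proof.
move=> theta0 lset Pj Pj1; set v := level theta j `^ p; set om := fine (mu (lset j)).
set u := level theta j.
have u0 : 0 < u by exact: level_gt0.
have mj := measurable_level_set s a theta.
have fj := level_set_fin_num p0 theta0 int_le1.
have om0 : 0 <= om by rewrite fine_ge0.
have C0 : 0 <= (8 * K + K `^ (2 / p - 1)) / 2.
  by rewrite divr_ge0// addr_ge0 ?powR_ge0// mulr_ge0.
(* A null level set cannot contain more than half of a rectangle, so the block is empty. *)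
have [omE|omn0] := eqVneq om 0.
  rewrite big1 => [|r /Pj]; first by rewrite omE !mulr0.
  rewrite (_ : mu (E r `&` lset j) = 0%E) ?mule0 ?ltNge ?measure_ge0//.
  have mu0 : mu (lset j) = 0%E by rewrite -(fineK (fj j)) -/lset -/om omE.
  apply/eqP; rewrite -measure_le0 -mu0.
  by apply: le_measure; rewrite ?in_setE//; exact: measurableI.
have {omn0}om0 : 0 < om by rewrite lt0r omn0.
have [|U [UU muU EU]] := cover (mj j); first by rewrite -ge0_fin_numE.
have mU := measurable_Us UU.
have muU' : (mu U <= (K * om)%:E)%E by rewrite EFinM fineK.
have fU : mu U \is a fin_num by rewrite ge0_fin_numE// (le_lt_trans muU')// ltry.
pose s' := [seq r <- s | P r].
rewrite -big_filter -/s'.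
have X : \sum_(r <- s') a r ^+ 2 <= 8 * K * u ^+ 2 * om.
  (* Off the next level set the square sum is at most [level theta j.+1 ^+ 2 = 4 * u ^+ 2]. *)
  rewrite [leRHS](_ : _ = 2 * level theta j.+1 ^+ 2 * (K * om)); last first.
    by rewrite /u /level (exprS 2 j); ring.
  apply: (level_block_square_le (U := U) (V := lset j.+1)) => //.
  - by rewrite sqr_ge0.
  - by move=> r; rewrite mem_filter => /andP[/Pj/EU].
  - by move=> r; rewrite mem_filter -muE => /andP[/Pj1].
  - move=> x /negP; rewrite -leNgt; apply: le_trans.
    exact: square_sum_filter_le.
have Y : \sum_(r <- s') b r ^+ 2 <= N ^+ 2 * (K `^ (2 / p - 1) * om `^ (2 / p - 1)).
  apply: (@le_trans _ _ (\sum_(r <- s | `[< E r `<=` U >]) b r ^+ 2)).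
    rewrite /s' big_filter big_mkcond [leRHS]big_mkcond; apply: ler_sum => r _.
    case: ifP => [/Pj/EU EUr|_]; first by rewrite asboolT.
    by case: ifP => // _; exact: sqr_ge0.
  apply: (le_trans (b_le UU _)); first by rewrite -ge0_fin_numE.
  rewrite ler_wpM2l ?sqr_ge0// -powRM ?(ltW om0)//.
  have q0 : 0 <= 2 / p - 1.
    by rewrite subr_ge0 ler_pdivlMr// mul1r (le_trans p1)// ler1n.
  apply: ge0_ler_powR; rewrite ?nnegrE ?fine_ge0// ?mulr_ge0 ?(ltW om0)//.
  by rewrite -lee_fin fineK.
(* AM-GM: [a b <= (l a^2 + b^2 / l) / 2] with [l = N rho / u] makes both sums
   multiples of [N u tau = N (v om)^(1/p)], and [v om <= 1] by Chebyshev. *)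
set rho := om `^ (p^-1 - 1); set tau := om `^ p^-1.
have rho0 : 0 < rho by rewrite powR_gt0.
have tauE : tau = rho * om.
  rewrite /tau /rho -[X in _ * X]powRr1 ?(ltW om0)// -powRD ?subrK//.
  by rewrite (gt_eqF om0) implybT.
have rhotau : om `^ (2 / p - 1) = rho * tau.
  rewrite /tau /rho -powRD; last by rewrite (gt_eqF om0) implybT.
  by congr (_ `^ _); ring.
(* An exponent [p^-1] of at least 1 does not increase a number in the unit interval; this leaves a
   bound linear in [v * om], which can be summed over the levels. *)
have utau : u * tau <= v * om.
  have vom : v * om = v * om by [].
  have -> : u * tau = (v * om) `^ p^-1.
    rewrite powRM ?powR_ge0 ?(ltW om0)// /v -powRrM mulfV ?gt_eqF//.
    by rewrite powRr1// ltW.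
  apply: ge1r_powR; last by rewrite invf_ge1.
  rewrite mulr_gt0 ?powR_gt0//= -lee_fin EFinM fineK//.
  exact: level_set_chebyshev.
pose l := N * rho / u.
have l0 : 0 < l by rewrite divr_gt0// mulr_gt0.
apply: (le_trans (am_gm_sum s' a b l0)).
apply: (@le_trans _ _ ((8 * K + K `^ (2 / p - 1)) / 2 * N * (u * tau))); last first.
  by rewrite ler_wpM2l// mulr_ge0// ltW.
rewrite [leRHS](_ : _ = (l * (8 * K * u ^+ 2 * om) +
    l^-1 * (N ^+ 2 * (K `^ (2 / p - 1) * om `^ (2 / p - 1)))) / 2); last first.
  rewrite rhotau tauE /l; field; rewrite !gt_eqF//.
rewrite ler_wpM2r// lerD// ler_wpM2l// ?invr_ge0 ltW//.
Qed.

Lemma finite_pairing_le :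
  \sum_(r <- s) a r * b r <= duality_const K p * N.
Proof.
have [theta theta0 low] := exists_low_level s a.
pose B := \sum_(r <- s) a r ^+ 2 / w r.
have B0 : 0 <= B by apply: sumr_ge0 => r _; rewrite divr_ge0 ?sqr_ge0// ltW.
(* [level theta J] is at least [B + 1], hence at least 1, so its square exceeds the upper bound [B]
   of the square sum and the level set [J] is empty. *)
pose J := (Num.truncn ((B + 1) / theta)).+1.
have BJ : B < level theta J ^+ 2.
  have h1 : B + 1 <= level theta J.
    rewrite /level mulrC -ler_pdivrMr//.
    apply: le_trans (ltW (truncnS_gt _)) _.
    by rewrite -natrX ler_nat ltnW// ltn_expl.
  apply: (@lt_le_trans _ _ (B + 1)); first by rewrite ltrDl.
  apply: (le_trans h1); rewrite expr2 ler_peMr ?(ltW (level_gt0 _ _))//.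
  by rewrite (le_trans _ h1)// lerDr.
(* More than half of the rectangle lies in the level set [j]. When [a r] is positive this holds at
   [j = 0] by the choice of [theta] and fails at [J], so it switches off at some index. *)
pose h (j : nat) r := (mu (E r) < 2%:E * mu (E r `&` level_set s a theta j))%E.
pose P (j : nat) r := [&& 0 < a r, h j r & ~~ h j.+1 r].
have hP r : r \in s -> 0 < a r -> exists j : 'I_J, P j r.
  move=> rs ar.
  have h0 : h 0%N r.
    rewrite /h setIidl ?muE; last first.
      move=> x Ex; rewrite /level_set/= /level expr0 mulr1.
      exact: lt_le_trans (low r rs ar) (square_sum_ge a rs Ex).
    by rewrite -EFinM lte_fin ltr_pMl// ltr1n.
  have hJ : ~~ h J r.
    rewrite /h (_ : level_set s a theta J = set0) ?setI0 ?measure0 ?mule0 -?leNgt//.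
    apply/seteqP; split => // x; rewrite /level_set/=; apply/negP.
    by rewrite -leNgt (le_trans (square_sum_le _ _ _))// ltW.
  elim: (J) hJ => [|k IH] hk; first by rewrite h0 in hk.
  have [hk'|/IH[j Pj]] := boolP (h k r).
    by exists ord_max; rewrite /P ar hk' hk.
  by exists (widen_ord (leqnSn k) j).
apply: (@le_trans _ _ (\sum_(r <- s) \sum_(j < J | P j r) a r * b r)).
  rewrite big_seq [leRHS]big_seq; apply: ler_sum => r rs.
  have [ar|ar] := ltP 0 (a r); last first.
    have -> : a r = 0 by apply/eqP; rewrite eq_le ar a0.
    by rewrite mul0r sumr_ge0// => j _; rewrite mul0r.
  have [j Pj] := hP r rs ar.
  by rewrite (bigD1 j)//= lerDl sumr_ge0// => i _; rewrite mulr_ge0.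
rewrite (exchange_big_dep xpredT)//=.
apply: (@le_trans _ _ (\sum_(j < J) (8 * K + K `^ (2 / p - 1)) / 2 * N *
     (level theta j `^ p * fine (mu (level_set s a theta j))))).
  apply: ler_sum => j _; apply: level_block_le => // r /and3P[_ //].
  by rewrite -leNgt.
rewrite -mulr_sumr /duality_const mulrAC ler_wpM2r ?(ltW N0)// mulrC.
rewrite ler_wpM2r//; last exact: level_set_sum.
by rewrite divr_ge0// addr_ge0 ?powR_ge0// mulr_ge0.
Qed.

End finite_pairing.

End finite_duality.

(** * Sequence spaces *)

#[local] Existing Instance totally_filter.

(** * Convergence of unordered sums *)

Section unordered_sums.
Context (R : realType) (I : choiceType).
Local Notation C := (R[i]).
Local Notation nrm := (@Normc.normc R).

Lemma esum_le_fset (S : set I) (a : I -> \bar R) (M : \bar R) :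
  (forall F : {fset I}, (forall r, r \in F -> S r) ->
    (\sum_(r <- F) a r <= M)%E) ->
  (\esum_(r in S) a r <= M)%E.
Proof.
move=> aM; apply: ub_ereal_sup => _ [X [finX XS] <-].
rewrite fsbig_finite//; apply: aM => r; rewrite in_fset_set// => /set_mem; exact: XS.
Qed.

Lemma fset_le_esum (S : set I) (a : I -> \bar R) (F : {fset I}) :
  (forall r, (0 <= a r)%E) -> (forall r, r \in F -> S r) ->
  (\sum_(r <- F) a r <= \esum_(r in S) a r)%E.
Proof.
move=> a0 FS; apply: esum_ge; exists [set` F]; first by split.
by rewrite fsbig_finite// set_fsetK.
Qed.

Lemma big_fset_subset_le (a : I -> R) (F F' : {fset I}) :
  (forall r, 0 <= a r) -> (F `<=` F')%fset ->
  \sum_(r <- F) a r <= \sum_(r <- F') a r.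
Proof.
move=> a0 FF'; rewrite -lee_fin -!sumEFin.
apply: (@le_trans _ _ (\esum_(r in [set` F']) (a r)%:E)).
  apply: fset_le_esum => [r|r rF /=]; first by rewrite lee_fin.
  exact: (fsubsetP FF').
rewrite esum_fset//; last by move=> r _; rewrite lee_fin.
by rewrite fsbig_finite//= set_fsetK.
Qed.

Lemma bounded_sum_cvg (a : I -> R) (M : R) : (forall r, 0 <= a r) ->
  (forall F : {fset I}, \sum_(r <- F) a r <= M) ->
  exists L : R, forall e : R, 0 < e -> exists F0 : {fset I},
    forall F : {fset I}, (F0 `<=` F)%fset -> `|L - \sum_(r <- F) a r| < e.
Proof.
move=> a0 aM; pose A := [set \sum_(r <- F) a r | F in [set: {fset I}]].
have supA : has_sup A.
  split; first by exists (\sum_(r <- fset0) a r), fset0.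
  by exists M => _ [F _ <-].
exists (sup A) => e e0; have [_ [F0 _ <-] F0e] := sup_adherent e0 supA.
exists F0 => F F0F; have F0F' := big_fset_subset_le a0 F0F.
have FA : \sum_(r <- F) a r <= sup A.
  by apply: ub_le_sup; [case: supA|exists F].
rewrite ger0_norm ?subr_ge0//; lra.
Qed.

Lemma normC_real (x : C) : `|x| = (nrm x)%:C%C.
Proof. by []. Qed.

(** The norm on [C^o] is complex-valued, so the radii of its balls are complex numbers with zero
    imaginary part; here they become real. *)
Lemma totally_cvgP (f : {fset I} -> C^o) (z : C^o) :
  f @ totally --> z <-> forall e : R, 0 < e -> exists F0 : {fset I},
    forall F : {fset I}, (F0 `<=` F)%fset -> nrm (z - f F) < e.
Proof.
split=> [/cvgrPdist_lt fz e e0|fz].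
  have e0' : (0 : C) < e%:C%C by rewrite ltcR.
  have [F0 _ F0P] := fz _ e0'.
  exists F0 => F F0F; have := F0P F F0F; rewrite /= normC_real ltcR//.
apply/cvgrPdist_lt => -[e1 e2]; rewrite ltcE/= => /andP[/eqP -> e0].
have [F0 F0P] := fz _ e0.
by exists F0 => // F F0F; rewrite /= normC_real ltcR; exact: F0P.
Qed.

(** The real and imaginary parts [f (x r)] are differences of the nonnegative families
    [f (x r) + nrm (x r)] and [nrm (x r)], whose finite sums are bounded and therefore converge. *)
Lemma bounded_csum_cvg (x : I -> C) (M : R) :
  (forall F : {fset I}, \sum_(r <- F) nrm (x r) <= M) ->
  cvg (@partial_sum I C^o x @ totally).
Proof.
move=> xM.
have part (f : C -> R) : (forall z, `|f z| <= nrm z) ->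
    exists L : R, forall e : R, 0 < e -> exists F0 : {fset I},
    forall F : {fset I}, (F0 `<=` F)%fset -> `|L - \sum_(r <- F) f (x r)| < e.
  move=> fP.
  have f0 r : 0 <= f (x r) + nrm (x r).
    by have := fP (x r); rewrite ler_norml => /andP[h _]; rewrite -lerBlDr sub0r.
  have [|L LP] := @bounded_sum_cvg (fun r => f (x r) + nrm (x r)) (M + M) f0.
    move=> F; rewrite big_split/= lerD//; apply: le_trans (xM F).
    by apply: ler_sum => r _; rewrite (le_trans (ler_norm _)).
  have [|L' LP'] := @bounded_sum_cvg (fun r => nrm (x r)) M _ xM.
    by move=> r; exact: (le_trans (normr_ge0 _) (fP (x r))).
  exists (L - L') => e e0; have e20 : 0 < e / 2 by rewrite divr_gt0.
  have [F1 F1P] := LP _ e20; have [F2 F2P] := LP' _ e20.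
  exists (F1 `|` F2)%fset => F; rewrite fsubUset => /andP[F1F F2F].
  have -> : L - L' - \sum_(r <- F) f (x r) =
      (L - \sum_(r <- F) (f (x r) + nrm (x r))) - (L' - \sum_(r <- F) nrm (x r)).
    by rewrite big_split/=; ring.
  by rewrite (le_lt_trans (ler_normB _ _))// (splitr e) ltrD ?F1P ?F2P.
have Re_le (z : C) : `|complex.Re z| <= nrm z.
  by rewrite -lecR -normC_real; exact: normc_ge_Re.
have Im_le (z : C) : `|complex.Im z| <= nrm z.
  case: z => u v /=; rewrite -sqrtr_sqr ler_sqrt ?lerDr ?sqr_ge0//.
  by rewrite addr_ge0 ?sqr_ge0.
have [L1 L1P] := part _ Re_le; have [L2 L2P] := part _ Im_le.
apply/cvg_ex; exists (L1 +i* L2)%C; apply/totally_cvgP => e e0.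
have e20 : 0 < e / 2 by rewrite divr_gt0.
have [F1 F1P] := L1P _ e20; have [F2 F2P] := L2P _ e20.
exists (F1 `|` F2)%fset => F; rewrite fsubUset => /andP[/F1P F1F /F2P F2F].
have nrm_le (u v : R) : nrm (u +i* v)%C <= `|u| + `|v|.
  rewrite /= -(ger0_norm (addr_ge0 (normr_ge0 u) (normr_ge0 v))) -sqrtr_sqr.
  rewrite ler_sqrt ?sqr_ge0//.
  rewrite sqrrD !real_normK ?num_real// lerD2r lerDl.
  by rewrite mulrn_wge0// mulr_ge0.
have -> : (L1 +i* L2)%C - partial_sum (R := C^o) x F =
    ((L1 - \sum_(r <- F) complex.Re (x r)) +i* (L2 - \sum_(r <- F) complex.Im (x r)))%C.
  rewrite /partial_sum -(big_seq_fsetE _ _ xpredT x).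
  have -> : \sum_(r <- F) complex.Re (x r) = complex.Re (\sum_(r <- F) x r).
    by rewrite raddf_sum.
  have -> : \sum_(r <- F) complex.Im (x r) = complex.Im (\sum_(r <- F) x r).
    by rewrite raddf_sum.
  by case: (\sum_(r <- F) x r).
rewrite (le_lt_trans (nrm_le _ _))// (splitr e) ltrD//.
Qed.

Lemma partial_sumE (x : I -> C^o) (F : {fset I}) :
  partial_sum x F = \sum_(r <- F) x r.
Proof. by rewrite /partial_sum -(big_seq_fsetE _ _ xpredT x). Qed.

Lemma sum_cvgP (x : I -> C^o) (z : C^o) :
  partial_sum x @ totally --> z -> sum x = z.
Proof. by move=> xz; apply: cvg_lim => //; exact: norm_hausdorff. Qed.

Lemma normc_big_le (s : seq I) (x : I -> C) :
  nrm (\sum_(r <- s) x r) <= \sum_(r <- s) nrm (x r).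
Proof.
elim: s => [|r s IH]; first by rewrite !big_nil Normc.normc0.
by rewrite !big_cons (le_trans (le_normcD _ _))// lerD2l.
Qed.

Lemma normc_sum_le (x : I -> C^o) (M : R) : cvg (partial_sum x @ totally) ->
  (forall F : {fset I}, \sum_(r <- F) nrm (x r) <= M) -> nrm (sum x) <= M.
Proof.
move=> cx xM; apply/ler_addgt0Pr => e e0.
have [F0 F0P] := (totally_cvgP _ _).1 cx _ e0.
have {F0P} := F0P F0 (fsubset_refl _); rewrite partial_sumE => F0e.
have -> : sum x = (sum x - \sum_(r <- F0) x r) + \sum_(r <- F0) x r by rewrite subrK.
apply: (le_trans (le_normcD _ _)); rewrite addrC lerD ?(ltW F0e)//.
exact: le_trans (normc_big_le _ _) (xM F0).
Qed.

End unordered_sums.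

(** The option type covers a finite index set; every index occurs exactly once, so series and
    unordered sums agree. *)
Lemma countable_enum (I : choiceType) : countable [set: I] ->
  exists g : nat -> option I, (forall r, exists k, g k = Some r) /\
    (forall k l r, g k = Some r -> g l = Some r -> k = l).
Proof.
move=> /countable_injP[f finj].
pose g k := if pselect (exists r, f r = k) is left h then Some (projT1 (cid h)) else None.
have gE k r : g k = Some r -> f r = k.
  by rewrite /g; case: pselect => // h [<-]; exact: projT2 (cid h).
exists g; split => [r|k l r /gE <- /gE //].
exists (f r); rewrite /g; case: pselect => [h|[]]; last by exists r.
by congr Some; apply: finj; rewrite ?in_setE//; exact: (projT2 (cid h)).
Qed.

(** A series gives access to measurability and to tails. *)
Lemma esum_enum (R : realType) (I : choiceType) (g : nat -> option I)
    (a : I -> \bar R) :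
  (forall r, exists k, g k = Some r) ->
  (forall k l r, g k = Some r -> g l = Some r -> k = l) ->
  (forall r, (0 <= a r)%E) ->
  (\esum_(r in [set: I]) a r = \sum_(0 <= k <oo) oapp a 0%E (g k))%E.
Proof.
move=> /choice[f fP] ginj a0.
have b0 k : (0 <= oapp a 0%E (g k))%E by case: (g k) => /=.
rewrite nneseries_esumT//.
have -> : \esum_(r in [set: I]) a r =
    \esum_(r in [set: I]) oapp a 0%E (g (f r)).
  by apply: eq_esum => r _; rewrite fP.
rewrite -(@reindex_esum _ _ _ setT (range f) f (fun k => oapp a 0%E (g k))).
  rewrite esum_mkcond; apply: eq_esum => k _; case: ifPn => //.
  rewrite notin_setE => nk; case e : (g k) => [r|//]; exfalso; apply: nk.
  by exists r => //; exact: (ginj _ _ r (fP r) e).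
split; first by move=> r _; exists r.
  by move=> r r' _ _ ff; have := fP r; rewrite ff fP => -[].
by move=> _ [r _ <-]; exists r.
Qed.

(** * The quasi-norm of s^p *)

Section sequence_norms.
Context (R : realType) (n : nat) (I : choiceType) (E : I -> set (heis R n)) (p : R).
Local Notation H := (heis R n).
Local Notation C := (R[i]).
Local Notation nrm := (@Normc.normc R).
Local Notation mu := (@heis_measure R n).
Hypotheses (p0 : 0 < p) (cI : countable [set: I]).
Hypothesis mE : forall r, measurable (E r).
Hypothesis muE_gt0 : forall r, (0 < mu (E r) < +oo)%E.
Let w r := fine (mu (E r)).

Let muE r : mu (E r) = (w r)%:E.
Proof. by have /andP[_ h] := muE_gt0 r; rewrite fineK// ge0_fin_numE. Qed.

Let w0 r : 0 < w r.
Proof. by rewrite -lte_fin -muE; have /andP[] := muE_gt0 r. Qed.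

Definition sq_term (s : I -> C) r x : \bar R :=
  (nrm (s r) ^+ 2 * (fine (mu (E r)))^-1 * \1_(E r) x)%:E.

Definition sq_esum s x := \esum_(r in [set: I]) sq_term s r x.

(** The [p]-th power of the quasi-norm; the exponent is [p / 2] since the root in the square
    function is absorbed. *)
Definition sp_mass s : \bar R := (\int[mu]_x (sq_esum s x `^ (p / 2)))%E.

Lemma normc_ge0 (z : C) : 0 <= nrm z.
Proof. by case: z => u v; exact: sqrtr_ge0. Qed.

Lemma sq_term_ge0 s r x : (0 <= sq_term s r x)%E.
Proof.
by rewrite lee_fin mulr_ge0 ?indicE ?ler0n// mulr_ge0 ?sqr_ge0// invr_ge0 ltW.
Qed.

Lemma sq_esum_ge0 s x : (0 <= sq_esum s x)%E.
Proof. by apply: esum_ge0 => r _; exact: sq_term_ge0. Qed.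

Lemma measurable_sq_esum s : measurable_fun setT (sq_esum s).
Proof.
have [g [gs gi]] := countable_enum cI.
rewrite (_ : sq_esum s =
    fun x => (\sum_(0 <= k <oo | k \in xpredT) oapp (fun r => sq_term s r x) 0%E (g k))%E).
  apply: ge0_emeasurable_sum => [k x _ _|k _].
    by case: (g k) => //= r; exact: sq_term_ge0.
  case: (g k) => [r|] /=; last exact: measurable_cst.
  by apply/measurable_EFinP/measurable_funM => //; exact: measurable_indic.
apply/funext => x; apply: esum_enum => // r; exact: sq_term_ge0.
Qed.

Lemma measurable_sq_esum_powR s q :
  measurable_fun setT (fun x => (sq_esum s x `^ q)%E).
Proof.
by apply: (measurableT_comp (measurable_poweR _)); exact: measurable_sq_esum.
Qed.

Lemma sp_norm_massE s : sp_norm E p s = (sp_mass s `^ p^-1)%E.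
Proof.
rewrite /sp_norm unlock; congr (_ `^ _)%E; apply: eq_integral => x _.
by rewrite gee0_abs ?poweR_ge0// /square_function -poweRrM mulrC.
Qed.

Lemma sp_mass_ge0 s : (0 <= sp_mass s)%E.
Proof. by apply: integral_ge0 => x _; exact: poweR_ge0. Qed.

Lemma sp_norm_ge0 s : (0 <= sp_norm E p s)%E.
Proof. by rewrite sp_norm_massE poweR_ge0. Qed.

Lemma sp_massE s : sp_mass s = (sp_norm E p s `^ p)%E.
Proof.
by rewrite sp_norm_massE -poweRrM mulVf ?gt_eqF// poweRe1// sp_mass_ge0.
Qed.

Lemma sp_norm_le s (c : R) : 0 <= c ->
  (sp_norm E p s <= c%:E)%E <-> (sp_mass s <= (c `^ p)%:E)%E.
Proof.
have oo (y : \bar R) : (0 <= y)%E -> y \in `[0, +oo]%E.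
  by move=> y0; rewrite in_itv/= y0 leey.
move=> c0; split => [sc|sc].
  rewrite sp_massE -poweR_EFin; apply: gt0_ler_poweR => //; first exact: ltW.
  - by apply: oo; exact: sp_norm_ge0.
  - by apply: oo; rewrite lee_fin.
rewrite sp_norm_massE (_ : c = (c `^ p) `^ p^-1).
  rewrite -poweR_EFin; apply: gt0_ler_poweR => //; first by rewrite invr_ge0 ltW.
  - by apply: oo; exact: sp_mass_ge0.
  - by apply: oo; rewrite lee_fin powR_ge0.
by rewrite -powRrM mulfV ?gt_eqF// powRr1.
Qed.

Lemma sp_mass_fin s : sp E p s <-> (sp_mass s < +oo)%E.
Proof.
rewrite /sp/= sp_massE; split; first exact: poweR_lty.
by apply: lty_poweRy; rewrite gt_eqF.
Qed.

Lemma sq_term_scale (c : C) s r x :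
  sq_term (fun r => c * s r) r x = ((nrm c ^+ 2)%:E * sq_term s r x)%E.
Proof. by rewrite /sq_term Normc.normcM exprMn -EFinM !mulrA. Qed.

Lemma square_sum_le_sq_esum (F : {fset I}) s x :
  ((square_sum E w F (fun r => nrm (s r)) x)%:E <= sq_esum s x)%E.
Proof.
rewrite -sumEFin; apply: fset_le_esum => // r; exact: sq_term_ge0.
Qed.

Lemma sq_esum_finite (F : {fset I}) s x : (forall r, r \notin F -> s r = 0) ->
  sq_esum s x = (square_sum E w F (fun r => nrm (s r)) x)%:E.
Proof.
move=> sF; apply/eqP; rewrite eq_le square_sum_le_sq_esum andbT.
rewrite /sq_esum (_ : esum _ _ = \esum_(r in [set` F]) sq_term s r x).
  apply: esum_le_fset => F' F'F; rewrite -sumEFin.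
  rewrite !sumEFin lee_fin; apply: big_fset_subset_le => [r|].
    by have := sq_term_ge0 s r x; rewrite lee_fin.
  exact/fsubsetP.
rewrite [RHS]esum_mkcond; apply: eq_esum => r _; case: ifPn => // rF.
rewrite /sq_term sF ?Normc.normc0 ?expr0n/= ?mul0r//.
by move: rF; rewrite notin_setE => /negP.
Qed.

Lemma sp_mass_scale (c : C) s :
  sp_mass (fun r => c * s r) = ((nrm c `^ p)%:E * sp_mass s)%E.
Proof.
rewrite /sp_mass -ge0_integralZl_EFin//; last 3 first.
- by move=> x _; exact: poweR_ge0.
- exact: measurable_sq_esum_powR.
- exact: powR_ge0.
apply: eq_integral => x _.
rewrite (_ : sq_esum _ x = ((nrm c ^+ 2)%:E * sq_esum s x)%E).
  rewrite poweRM ?sq_esum_ge0 ?lee_fin ?sqr_ge0// poweR_EFin.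
  by rewrite powR_sqr_half// normc_ge0.
have [g [gs gi]] := countable_enum cI.
rewrite /sq_esum !(esum_enum gs gi); try by move=> r; exact: sq_term_ge0.
rewrite -nneseriesZl; last by move=> k _; case: (g k) => //= r; exact: sq_term_ge0.
apply: eq_eseriesr => k _; case: (g k) => [r|] /=; last by rewrite mule0.
exact: sq_term_scale.
Qed.

End sequence_norms.

(** A concave power lies below its tangent at [c]. This is Young's inequality with exponents [th^-1]
    and [(1 - th)^-1] for the [th]-th power of [y / c] and 1, then rescaled. *)
Lemma powR_tangent (R : realType) (th y c : R) : 0 < th < 1 -> 0 <= y -> 0 < c ->
  y `^ th <= th * c `^ (th - 1) * y + (1 - th) * c `^ th.
Proof.
move=> /andP[th0 th1] y0 c0.
have h := @conjugate_powR R ((y / c) `^ th) 1 th^-1 (1 - th)^-1 (powR_ge0 _ _) ler01.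
have {}h : (y / c) `^ th <= th * (y / c) + (1 - th).
  have -> : (y / c) `^ th = (y / c) `^ th * 1 by rewrite mulr1.
  apply: le_trans (h _ _ _) _; rewrite ?invr_gt0 ?subr_gt0//.
    by rewrite !invrK; ring.
  rewrite !invrK powR1 mul1r -powRrM mulfV ?gt_eqF//.
  by rewrite powRr1 ?divr_ge0 ?(ltW c0)// [_ * th]mulrC.
have cth : 0 < c `^ th by rewrite powR_gt0.
have -> : y `^ th = (y / c) `^ th * c `^ th.
  by rewrite -powRM ?divr_ge0 ?(ltW c0)// divfK ?gt_eqF.
have -> : c `^ (th - 1) = c `^ th / c.
  by rewrite powRB ?powRr1 ?(ltW c0)// (gt_eqF c0) implybT.
apply: (le_trans (ler_wpM2r (ltW cth) h)); rewrite mulrDl lerD2r.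
by rewrite [leLHS](_ : _ = th * (c `^ th / c) * y)//; ring.
Qed.

Lemma powR_mulr (R : realType) (x q : R) : 0 < x -> x `^ q * x = x `^ (q + 1).
Proof.
move=> x0; rewrite powRD ?powRr1 ?(ltW x0)//.
by rewrite (gt_eqF x0) implybT.
Qed.

(** * Boundedness of the pairing, and duality *)

Section sequence_duality.
Context (R : realType) (n : nat) (I : choiceType) (E : I -> set (heis R n)) (p : R).
Local Notation H := (heis R n).
Local Notation C := (R[i]).
Local Notation nrm := (@Normc.normc R).
Local Notation mu := (@heis_measure R n).
Hypotheses (p0 : 0 < p) (p1 : p <= 1) (cI : countable [set: I]).
Hypothesis mE : forall r, measurable (E r).
Hypothesis muE_gt0 : forall r, (0 < mu (E r) < +oo)%E.
Hypothesis open_measurableH : forall U : set H, open U -> measurable U.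
Context (K : R).
Hypothesis K0 : 0 <= K.
Hypothesis cover : forall A : set H, measurable A -> (mu A < +oo)%E ->
  exists U, [/\ open U, (mu U <= K%:E * mu A)%E &
    forall r : I, (mu (E r) < 2%:E * mu (E r `&` A))%E -> E r `<=` U].
Let w r := fine (mu (E r)).

Let muE r : mu (E r) = (w r)%:E.
Proof. by have /andP[_ h] := muE_gt0 r; rewrite fineK// ge0_fin_numE. Qed.

Let w0 r : 0 < w r.
Proof. by rewrite -lte_fin -muE; have /andP[] := muE_gt0 r. Qed.

Let in0oo (y : \bar R) : (0 <= y)%E -> y \in `[0, +oo]%E.
Proof. by move=> y0; rewrite in_itv/= y0 leey. Qed.

(** Removes the root, the quotient and the infinite sum from the supremum. *)
Lemma cp_norm_le t (N : R) : 0 <= N ->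
  (cp_norm E p t <= N%:E)%E <->
  (forall U, open U -> (mu U < +oo)%E -> forall F : {fset I},
    (forall r, r \in F -> E r `<=` U) ->
    \sum_(r <- F) nrm (t r) ^+ 2 <= N ^+ 2 * fine (mu U) `^ (2 / p - 1)).
Proof.
move=> N0; split => [tN U oU Uoo F FU|tN].
  have [->|[r rF]] := fset_0Vmem F.
    by rewrite big_seq_fset0 mulr_ge0 ?sqr_ge0// powR_ge0.
  have mU := open_measurableH oU.
  (* A nonempty [F] puts a rectangle inside [U], so [U] has positive measure. *)
  have V0 : 0 < fine (mu U) `^ (2 / p - 1).
    rewrite powR_gt0// fine_gt0// Uoo andbT.
    have /andP[r0 _] := muE_gt0 r; apply: (lt_le_trans r0).
    by apply: le_measure; rewrite ?in_setE//; exact: FU.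
  rewrite -ler_pdivrMr// mulrC.
  set V := _ `^ _ in V0 *.
  pose Z := ((V^-1)%:E * \esum_(r in [set r | E r `<=` U]) (nrm (t r) ^+ 2)%:E)%E.
  have Z0 : (0 <= Z)%E.
    rewrite mule_ge0 ?lee_fin ?invr_ge0 ?(ltW V0)//.
    by apply: esum_ge0 => i _; rewrite lee_fin sqr_ge0.
  have ZN : (Z `^ 2^-1 <= N%:E)%E.
    by apply: le_trans tN; apply: ereal_sup_ubound; exists U.
  have {}ZN : (Z <= (N ^+ 2)%:E)%E.
    rewrite -(poweRe1 Z0) -[1](@mulVf _ 2%R) ?pnatr_eq0// poweRrM.
    rewrite -powR_mulrn// -poweR_EFin; apply: gt0_ler_poweR => //.
      by apply: in0oo; exact: poweR_ge0.
    by apply: in0oo; rewrite lee_fin.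
  rewrite -lee_fin; apply: le_trans ZN; rewrite EFinM lee_wpmul2l//.
    by rewrite lee_fin invr_ge0 ltW.
  rewrite -sumEFin; apply: fset_le_esum => [i|i /FU//].
  by rewrite lee_fin sqr_ge0.
apply: ub_ereal_sup => _ [U [oU Uoo] <-].
set V := _ `^ _; set X := esum _ _.
have V0 : 0 <= V by exact: powR_ge0.
have X0 : (0 <= X)%E by apply: esum_ge0 => i _; rewrite lee_fin sqr_ge0.
have XN : (X <= (N ^+ 2 * V)%:E)%E.
  by apply: esum_le_fset => F FU; rewrite sumEFin lee_fin; exact: tN.
have ZN : ((V^-1)%:E * X <= (N ^+ 2)%:E)%E.
  apply: (@le_trans _ _ ((V^-1)%:E * (N ^+ 2 * V)%:E)%E).
    by rewrite lee_wpmul2l// lee_fin invr_ge0.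
  (* For [V = 0] the inverse is 0 by convention and the left side vanishes. *)
  rewrite -EFinM lee_fin mulrCA; have [->|Vn0] := eqVneq V 0.
    by rewrite mulr0 mulr0 sqr_ge0.
  by rewrite mulVf// mulr1.
rewrite -[N in leRHS](powRr1 N0) -[X in N `^ X](@mulfV _ 2%R) ?pnatr_eq0//.
rewrite powRrM powR_mulrn// -poweR_EFin; apply: gt0_ler_poweR => //.
  by apply: in0oo; rewrite mule_ge0// lee_fin invr_ge0.
by apply: in0oo; rewrite lee_fin sqr_ge0.
Qed.

Lemma nrm_conj (z : C) : nrm (z^*)%C = nrm z.
Proof. by case: z => u v /=; rewrite sqrrN. Qed.

(** By homogeneity [s] is divided by [sg], which brings its mass down to at most 1. *)
Lemma pairing_fset_le s t (sg N : R) (F : {fset I}) : 0 < sg -> 0 < N ->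
  (sp_norm E p s <= sg%:E)%E -> (cp_norm E p t <= N%:E)%E ->
  \sum_(r <- F) nrm (s r) * nrm (t r) <= duality_const K p * sg * N.
Proof.
move=> sg0 N0 ssg tN.
pose s' r := ((sg^-1)%:C%C * s r : C).
have nc : nrm ((sg^-1)%:C%C) = sg^-1.
  by rewrite /= expr0n/= addr0 sqrtr_sqr ger0_norm// invr_ge0 ltW.
have s'E r : nrm (s' r) = sg^-1 * nrm (s r) by rewrite Normc.normcM nc.
have : \sum_(r <- F) nrm (s' r) * nrm (t r) <= duality_const K p * N.
  apply: (@finite_pairing_le _ _ _ mu _ E w mE muE w0 [set U | open U] K p) => //.
  - by move=> r; exact: normc_ge0.
  - by move=> r; exact: normc_ge0.
  - apply: (@le_trans _ _ (sp_mass E p s')).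
      apply: ge0_le_integral => //.
      + by move=> x _; rewrite lee_fin powR_ge0.
      + exact: measurable_square_sum_powR.
      + exact: measurable_sq_esum_powR.
      + move=> x _; rewrite -poweR_EFin; apply: gt0_ler_poweR.
        * by rewrite divr_ge0// ltW.
        * by apply: in0oo; rewrite lee_fin square_sum_ge0.
        * by apply: in0oo; exact: sq_esum_ge0.
        * exact: square_sum_le_sq_esum.
    rewrite sp_mass_scale// nc.
    have := (sp_norm_le E p0 s (ltW sg0)).1 ssg => smass.
    apply: (@le_trans _ _ ((sg^-1 `^ p)%:E * (sg `^ p)%:E)%E).
      by rewrite lee_wpmul2l// lee_fin powR_ge0.
    rewrite -EFinM -powRM ?invr_ge0 ?(ltW sg0)//.
    by rewrite mulVf ?gt_eqF// powR1.
  - move=> U oU Uoo; rewrite big_fset_condE.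
    apply: ((cp_norm_le t (ltW N0)).1 tN U oU Uoo) => r.
    by rewrite !inE/= => /andP[_ /asboolP].
under eq_bigr do rewrite s'E -mulrA.
rewrite -mulr_sumr => h.
have -> : duality_const K p * sg * N = sg * (duality_const K p * N) by ring.
by rewrite -ler_pdivrMl.
Qed.

Lemma nrm_pairing_term (s t : I -> C) r :
  nrm (pairing_term s t r) = nrm (s r) * nrm (t r).
Proof. by rewrite /pairing_term Normc.normcM nrm_conj. Qed.

Lemma duality_const_ge0 : 0 <= duality_const K p.
Proof.
rewrite mulr_ge0//; last by rewrite divr_ge0// addr_ge0 ?powR_ge0// mulr_ge0.
have q1 : 1 < 2 `^ p :> R.
  by have := @ltr_powRE _ 1 2 p p0; rewrite powR1 => ->; rewrite ?ltr1n.
by rewrite invr_ge0 subr_ge0 invf_le1 ?ltW// (lt_trans _ q1).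
Qed.

Lemma cp_norm_ge0 t : (0 <= cp_norm E p t)%E.
Proof.
apply: ereal_sup_ubound; exists set0.
  by split; [exact: open0|rewrite measure0].
rewrite measure0 /= powR0 ?invr0 ?mul0e; last first.
  rewrite gt_eqF// subr_gt0 ltr_pdivlMr// mul1r.
  by rewrite (le_lt_trans p1)// ltr1n.
by rewrite poweR_EFin powR0// invr_neq0.
Qed.

(** The added 1 keeps the bound positive when the norm vanishes, as the pairing bounds require. *)
Lemma sp_le_fine s : sp E p s ->
  (sp_norm E p s <= (fine (sp_norm E p s) + 1)%:E)%E.
Proof.
move=> ss; rewrite EFinD fineK ?leeDl//.
by rewrite ge0_fin_numE// sp_norm_ge0.
Qed.

Lemma cp_le_fine t (e : R) : cp E p t -> 0 <= e ->
  (cp_norm E p t <= (fine (cp_norm E p t) + e)%:E)%E.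
Proof.
move=> ct e0; rewrite EFinD fineK ?leeDl ?lee_fin//.
by rewrite ge0_fin_numE// cp_norm_ge0.
Qed.

Lemma pairing_cvg s t : sp E p s -> cp E p t ->
  cvg (partial_sum (pairing_term s t) @ totally).
Proof.
move=> ss ct; apply: (@bounded_csum_cvg _ _ _ (duality_const K p *
  (fine (sp_norm E p s) + 1) * (fine (cp_norm E p t) + 1))) => F.
under eq_bigr do rewrite nrm_pairing_term.
apply: pairing_fset_le.
- by rewrite ltr_wpDl// fine_ge0// sp_norm_ge0.
- by rewrite ltr_wpDl// fine_ge0// cp_norm_ge0.
- exact: sp_le_fine.
- exact: cp_le_fine.
Qed.

Lemma pairing_le s t (sg N : R) : 0 < sg -> 0 < N ->
  (sp_norm E p s <= sg%:E)%E -> (cp_norm E p t <= N%:E)%E ->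
  nrm (pairing s t) <= duality_const K p * sg * N.
Proof.
move=> sg0 N0 ssg tN; apply: normc_sum_le => [|F].
  by apply: pairing_cvg; [exact: le_lt_trans ssg (ltry _)|exact: le_lt_trans tN (ltry _)].
under eq_bigr do rewrite nrm_pairing_term.
exact: pairing_fset_le.
Qed.

Lemma pairing_linear (a : C) s s' t : sp E p s -> sp E p s' -> cp E p t ->
  pairing (a *: s + s') t = a * pairing s t + pairing s' t.
Proof.
move=> ss ss' ct; apply: sum_cvgP.
have cs := pairing_cvg ss ct; have cs' := pairing_cvg ss' ct.
rewrite (_ : partial_sum _ = (fun F => a *: partial_sum (pairing_term s t) F +
    partial_sum (pairing_term s' t) F)).
  by apply: cvgD; [apply: (@cvgZl_tmp _ C^o _ _ _ a); exact: cs|exact: cs'].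
apply/funext => F; rewrite !partial_sumE scaler_sumr -big_split/=.
apply: eq_bigr => r _; rewrite /pairing_term.
have -> : (a *: s + s') r = a * s r + s' r by [].
by rewrite mulrDl -mulrA.
Qed.

Lemma pairing_sp_dual t : cp E p t -> sp_dual E p (fun s => pairing s t).
Proof.
move=> ct; split=> [a s s' ss ss'|s0 ss0 e e0]; first exact: pairing_linear.
pose N := fine (cp_norm E p t) + 1.
have N0 : 0 < N by rewrite ltr_wpDl// fine_ge0// cp_norm_ge0.
have D0 := duality_const_ge0.
(* The added 1 makes the divisor positive and the final inequality strict. *)
have DN0 : 0 < duality_const K p * N + 1 by rewrite ltr_wpDl// mulr_ge0// ltW.
exists (e / (duality_const K p * N + 1)); first by rewrite divr_gt0.
move=> s ss sd.
have -> : pairing s t - pairing s0 t = pairing (s - s0) t.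
  have -> : s - s0 = (-1 : C) *: s0 + s by rewrite scaleN1r addrC.
  by rewrite pairing_linear// mulN1r addrC.
have tN : (cp_norm E p t <= N%:E)%E by exact: cp_le_fine.
apply: le_lt_trans (pairing_le (divr_gt0 e0 DN0) N0 (ltW sd) tN) _.
rewrite (_ : _ * _ * N = e * ((duality_const K p * N) / (duality_const K p * N + 1))).
  by rewrite gtr_pMr// ltr_pdivrMr// mul1r ltrDl.
move: (_ + 1)^-1 => X; ring.
Qed.

(** [pairing_le] asks for a positive bound on [t], so it is applied with a slack
    [e / (duality_const K p + 1)] above the norm, and [e] is arbitrary. *)
Lemma sp_dual_norm_pairing_le t : cp E p t ->
  (sp_dual_norm E p (fun s => pairing s t) <=
    (duality_const K p + 1)%:E * cp_norm E p t)%E.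
Proof.
move=> ct; apply: ub_ereal_sup => _ [s /= ss <-].
have D0 := duality_const_ge0.
have fN : cp_norm E p t \is a fin_num by rewrite ge0_fin_numE// cp_norm_ge0.
rewrite -(fineK fN) -EFinM lee_fin; set c := fine _.
have c0 : 0 <= c by rewrite fine_ge0// cp_norm_ge0.
apply/ler_addgt0Pr => e e0.
have e'0 : 0 < e / (duality_const K p + 1) by rewrite divr_gt0// ltr_wpDl.
have := @pairing_le s t 1 (c + e / (duality_const K p + 1)) ltr01 _ ss _.
move=> /(_ (ltr_wpDl c0 e'0) (cp_le_fine ct (ltW e'0))) h; apply: (le_trans h).
rewrite mulr1 mulrDr mulrDl mul1r -addrA lerD2l.
apply: (@le_trans _ _ e); last by rewrite lerDr.
by rewrite mulrCA ger_pMr// ler_pdivrMr ?mul1r ?lerDl// ltr_wpDl.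
Qed.

(** The power [p / 2] is replaced by its tangent at [c] and integrated over [U]; outside [U] the
    square sum vanishes. The point [c] stays free for a later normalisation. *)
Lemma integral_square_sum_powR_le (F : seq I) (a : I -> R) (U : set H) (c : R) :
  measurable U -> (mu U < +oo)%E -> (forall r, r \in F -> E r `<=` U) -> 0 < c ->
  (\int[mu]_x (square_sum E w F a x `^ (p / 2))%:E <=
    (p / 2 * c `^ (p / 2 - 1) * (\sum_(r <- F) a r ^+ 2) +
     (1 - p / 2) * c `^ (p / 2) * fine (mu U))%:E)%E.
Proof.
move=> mU Uoo FU c0.
have th : 0 < p / 2 < 1.
  by rewrite divr_gt0//= ltr_pdivrMr// mul1r (le_lt_trans p1)// ltr1n.
have /andP[th0 th1] := th.
set k1 := p / 2 * _; set k2 := (1 - p / 2) * _.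
have k10 : 0 <= k1 by rewrite mulr_ge0 ?powR_ge0// ltW.
have k20 : 0 <= k2 by rewrite mulr_ge0 ?powR_ge0// subr_ge0 ltW.
have mG := measurable_square_sum w mE F a.
apply: (@le_trans _ _ (\int[mu]_x (k1 * square_sum E w F a x + k2 * \1_U x)%:E)%E).
  apply: ge0_le_integral => //.
  - by move=> x _; rewrite lee_fin powR_ge0.
  - exact: measurable_square_sum_powR.
  - apply/measurable_EFinP/measurable_funD; exact: measurable_funM.
  - move=> x _; rewrite lee_fin; have [Ux|nUx] := pselect (U x).
      rewrite indicE mem_set// mulr1; apply: powR_tangent => //.
      exact: square_sum_ge0.
    rewrite (_ : square_sum _ _ _ _ _ = 0).
      by rewrite powR0 ?gt_eqF// mulr0 add0r mulr_ge0// indicE.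
    rewrite /square_sum big_seq big1// => r rF.
    by rewrite indicE memNset ?mulr0// => Ex; apply: nUx; exact: (FU r rF).
under eq_integral do rewrite EFinD.
rewrite ge0_integralD//; last 4 first.
- by move=> x _; rewrite lee_fin mulr_ge0 ?square_sum_ge0.
- by apply/measurable_EFinP; exact: measurable_funM.
- by move=> x _; rewrite lee_fin mulr_ge0// indicE.
- by apply/measurable_EFinP/measurable_funM => //; exact: measurable_indic.
rewrite EFinD leeD//.
  under eq_integral do rewrite EFinM.
  rewrite ge0_integralZl_EFin//; last 2 first.
  - by move=> x _; rewrite lee_fin square_sum_ge0.
  - exact/measurable_EFinP.
  by rewrite integral_square_sum.
under eq_integral do rewrite EFinM.
rewrite ge0_integralZl_EFin//; last by apply/measurable_EFinP; exact: measurable_indic.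
by rewrite integral_indic// setIT [leRHS]EFinM fineK// ge0_fin_numE.
Qed.

Lemma sp_mass_finiteE (F : {fset I}) (s : I -> C) :
  (forall r, r \notin F -> s r = 0) ->
  sp_mass E p s =
    (\int[mu]_x (square_sum E w F (fun r => nrm (s r)) x `^ (p / 2))%:E)%E.
Proof.
move=> sF; apply: eq_integral => x _.
by rewrite (@sq_esum_finite _ _ _ E F s x sF) poweR_EFin.
Qed.

Lemma finite_union_fin (F : seq I) : exists U : set H,
  [/\ measurable U, (mu U < +oo)%E & forall r, r \in F -> E r `<=` U].
Proof.
elim: F => [|r F [U [mU Uoo FU]]]; first by exists set0; rewrite measure0.
exists (E r `|` U); split; first exact: measurableU.
  apply: (le_lt_trans (measureU2 _ _ _)) => //.
  by have /andP[_ Eoo] := muE_gt0 r; exact: lte_add_pinfty.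
by move=> q; rewrite inE => /predU1P[-> x ?|/FU FUq x /FUq ?]; [left|right].
Qed.

Lemma sp_finite (F : {fset I}) (s : I -> C) :
  (forall r, r \notin F -> s r = 0) -> sp E p s.
Proof.
move=> sF; apply/(sp_mass_fin E p0); rewrite (sp_mass_finiteE sF).
have [U [mU Uoo FU]] := finite_union_fin F.
apply: le_lt_trans (ltry _).
exact: (integral_square_sum_powR_le _ mU Uoo FU ltr01).
Qed.

Definition unit_seq (r : I) : I -> C := fun q => (q == r)%:R.

(** The restriction of [s] to a finite set, written as a linear combination so that a functional can
    be evaluated by linearity. *)
Definition combination (F : seq I) (s : I -> C) : I -> C :=
  \sum_(r <- F) s r *: unit_seq r.

Lemma combinationE (F : seq I) s q :
  combination F s q = \sum_(r <- F) s r * (q == r)%:R.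
Proof. by rewrite /combination fct_sumE. Qed.

Lemma combination_notin (F : seq I) s q : q \notin F -> combination F s q = 0.
Proof.
move=> qF; rewrite combinationE big_seq big1// => r rF.
by case: eqVneq => [qr|_]; [rewrite qr rF in qF|rewrite mulr0].
Qed.

Lemma combination_fset (F : {fset I}) s q :
  combination F s q = if q \in F then s q else 0.
Proof.
case: ifPn => [qF|]; last exact: combination_notin.
rewrite combinationE (bigD1_seq q)//= eqxx mulr1 big1 ?addr0// => r rq.
by rewrite eq_sym (negbTE rq) mulr0.
Qed.

Lemma sp_combination (F : seq I) s : sp E p (combination F s).
Proof.
apply: (@sp_finite [fset r in F]%fset) => r; rewrite !inE => rF.
exact: combination_notin.
Qed.

Lemma sp_unit_seq r : sp E p (unit_seq r).
Proof.
apply: (@sp_finite [fset r]%fset) => q; rewrite inE => /negbTE qr.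
by rewrite /unit_seq qr.
Qed.

Lemma sp0 : sp E p (0 : I -> C).
Proof. by apply: (@sp_finite fset0). Qed.

Lemma sp_norm_lt s (d : R) : 0 < d -> (sp_mass E p s < (d `^ p)%:E)%E ->
  (sp_norm E p s < d%:E)%E.
Proof.
move=> d0; rewrite !ltNge; apply: contra => ds; rewrite sp_massE// -poweR_EFin.
apply: gt0_ler_poweR => //; first exact: ltW.
  by apply: in0oo; rewrite lee_fin ltW.
by apply: in0oo; exact: sp_norm_ge0.
Qed.

(** The difference is 0 on [F] and [- s] elsewhere, so once [F] contains the first [k] enumerated
    indices only a tail remains. *)
Lemma sq_esum_combination_sub (g : nat -> option I) (s : I -> C) (F : {fset I})
    (k : nat) x :
  (forall r, exists k, g k = Some r) ->
  (forall k l r, g k = Some r -> g l = Some r -> k = l) ->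
  (forall j r, (j < k)%N -> g j = Some r -> r \in F) ->
  (sq_esum E (combination F s - s)%R x <=
    \sum_(k <= j <oo) oapp (fun r => sq_term E s r x) 0 (g j))%E.
Proof.
move=> gs gi gF.
have sub r : (combination F s - s) r = if r \in F then 0 else - s r.
  have -> : (combination F s - s) r = combination F s r - s r by [].
  by rewrite combination_fset; case: ifP; rewrite ?subrr ?sub0r.
rewrite /sq_esum (esum_enum gs gi); last by move=> r; exact: sq_term_ge0.
rewrite (nneseries_split _ k); last first.
  by move=> j _; case: (g j) => //= r; exact: sq_term_ge0.
rewrite add0n big_nat big1 ?add0e.
  apply: lee_nneseries => [j _ _|j _].
    by case: (g j) => //= r; exact: sq_term_ge0.
  case: (g j) => //= r; rewrite /sq_term lee_fin sub; case: ifP => _.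
    rewrite Normc.normc0 expr0n/= !mul0r.
    by have := sq_term_ge0 E s r x; rewrite lee_fin.
  by rewrite normcN.
move=> j /andP[_ jk]; case e : (g j) => [r|//] /=.
by rewrite /sq_term sub (gF j r jk e) Normc.normc0 expr0n/= !mul0r.
Qed.

(** Dominated convergence for the tails of the square function, the full square function being the
    majorant. [F] contains a prescribed [F0] so that one finite set can serve two limits. *)
Lemma sp_combination_dense s (F0 : {fset I}) (d : R) : sp E p s -> 0 < d ->
  exists2 F : {fset I}, (F0 `<=` F)%fset &
    (sp_norm E p (combination F s - s)%R < d%:E)%E.
Proof.
move=> ss d0; have [g [gs gi]] := countable_enum cI.
pose tail k x := (\sum_(k <= j <oo) oapp (fun r => sq_term E s r x) 0 (g j))%E.
pose f k x := (tail k x `^ (p / 2))%E.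
have u0 x j : (0 <= oapp (fun r => sq_term E s r x) 0 (g j))%E.
  by case: (g j) => //= r; exact: sq_term_ge0.
have tail_ge0 k x : (0 <= tail k x)%E by apply: nneseries_ge0 => j _ _.
have tail_le k x : (tail k x <= sq_esum E s x)%E.
  rewrite /sq_esum (esum_enum gs gi); last by move=> r; exact: sq_term_ge0.
  rewrite (nneseries_split _ k); last by move=> j _.
  by rewrite add0n leeDr// sume_ge0.
have mtail k : measurable_fun setT (tail k).
  rewrite (_ : tail k = fun x =>
      (\sum_(0 <= j <oo | j \in leq k) oapp (fun r => sq_term E s r x) 0 (g j))%E).
    apply: ge0_emeasurable_sum => [j x _ _|j _]; first exact: u0.
    case: (g j) => [r|] /=; last exact: measurable_cst.
    by apply/measurable_EFinP/measurable_funM => //; exact: measurable_indic.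
  by apply/funext => x; rewrite /tail eseries_cond.
have p20 : 0 < p / 2 by rewrite divr_gt0.
have mf k : measurable_fun setT (f k).
  by apply: (measurableT_comp (measurable_poweR _)).
pose h x := (sq_esum E s x `^ (p / 2))%E.
have f_le k x : (f k x <= h x)%E.
  by apply: gt0_ler_poweR; rewrite ?(ltW p20)//; apply: in0oo => //; exact: sq_esum_ge0.
have hint : mu.-integrable setT h.
  apply/integrableP; split; first exact: measurable_sq_esum_powR.
  under eq_integral do rewrite gee0_abs ?poweR_ge0//.
  exact/(sp_mass_fin E p0).
have [_ _ fcvg] : [/\ mu.-integrable setT (cst 0%E),
    (\int[mu]_x `|f k x - cst 0%E x|)%E @[k --> \oo] --> 0%E &
    (\int[mu]_x f k x)%E @[k --> \oo] --> (\int[mu]_x (cst 0%E x))%E].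
  apply: (@dominated_convergence _ _ _ mu setT measurableT f (cst 0%E) h) => //.
    (* Integrability makes the sum finite almost everywhere, and there its tails tend to 0. *)
    have := integrable_ae measurableT hint; apply: filterS => x hx _.
    have {hx}sx : (sq_esum E s x < +oo)%E.
      have := hx Logic.I; rewrite ge0_fin_numE ?poweR_ge0//.
      by apply: lty_poweRy; rewrite gt_eqF.
    have tfin k : tail k x \is a fin_num.
      by rewrite ge0_fin_numE// (le_lt_trans (tail_le k x)).
    have : tail k x @[k --> \oo] --> 0%E.
      apply: nneseries_tail_cvg => //; apply: le_lt_trans sx.
      exact: (tail_le 0%N x).
    move=> /fine_cvgP[_ /cvgrPdist_lt t0].
    apply/fine_cvgP; split.
      apply: nearW => k; rewrite /f -(fineK (tfin k)) poweR_EFin//.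
    apply/cvgrPdist_lt => e e0.
    have e20 : 0 < e `^ (p / 2)^-1 by rewrite powR_gt0.
    have := t0 _ e20; apply: filterS => k /=.
    rewrite !sub0r !normrN /f => tk.
    rewrite -(fineK (tfin k)) poweR_EFin/= ger0_norm ?powR_ge0//.
    rewrite ger0_norm ?fine_ge0// in tk.
    have -> : e = (e `^ (p / 2)^-1) `^ (p / 2).
      by rewrite -powRrM mulVf ?powRr1 ?ltW// gt_eqF.
    by rewrite ltr_powRE// ?fine_ge0// ltW.
  apply: nearW => x k _; rewrite gee0_abs; last exact: poweR_ge0.
  exact: f_le.
rewrite integral0 in fcvg.
have [k fk] : exists k, (\int[mu]_x f k x < (d `^ p)%:E)%E.
  have /fine_cvgP[[k1 _ k1P] /cvgrPdist_lt] := fcvg.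
  have dp0 : 0 < d `^ p by rewrite powR_gt0.
  move=> /(_ _ dp0)[k2 _ k2P]; exists (maxn k1 k2).
  have := k2P _ (leq_maxr k1 k2); have := k1P _ (leq_maxl k1 k2) => /= ffin.
  rewrite sub0r normrN ger0_norm => [|]; last first.
    by apply: fine_ge0; apply: integral_ge0 => x _; exact: poweR_ge0.
  by rewrite -lte_fin fineK.
pose F := (F0 `|` [fset r in pmap g (iota 0 k)])%fset.
exists F; first exact: fsubsetUl.
apply: sp_norm_lt => //; apply: le_lt_trans fk.
apply: ge0_le_integral => //.
- by move=> x _; exact: poweR_ge0.
- exact: measurable_sq_esum_powR.
- move=> x _; apply: gt0_ler_poweR; rewrite ?(ltW p20)//.
  + by apply: in0oo; exact: sq_esum_ge0.
  + by apply: in0oo; exact: tail_ge0.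
  apply: sq_esum_combination_sub => // j r jk gj.
  rewrite !inE mem_pmap; apply/orP; right; apply/mapP.
  by exists j => //; rewrite mem_iota.
Qed.

(** * Representation of continuous functionals *)

Section functional.
Context (l : (I -> C) -> C).
Hypothesis dl : sp_dual E p l.

Lemma dual_linear (a : C) s s' : sp E p s -> sp E p s' ->
  l (a *: s + s') = a * l s + l s'.
Proof. by have [+ _] := dl; exact. Qed.

Lemma dual0 : l 0 = 0.
Proof.
have := dual_linear 1 sp0 sp0; rewrite scaler0 addr0 mul1r => /eqP.
by rewrite -subr_eq0 opprD addrA subrr sub0r oppr_eq0 => /eqP.
Qed.

Lemma dual_combination F s :
  l (combination F s) = \sum_(r <- F) s r * l (unit_seq r).
Proof.
elim: F => [|r F IH]; first by rewrite /combination !big_nil dual0.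
rewrite /combination !big_cons dual_linear ?IH//; first exact: sp_unit_seq.
exact: sp_combination.
Qed.

(* Tests [l] on [t] restricted to the rectangles inside [U], normalised by [sg].
   The tangent-line bound of [y^(p/2)] at [y = c] replaces Hoelder's inequality. *)
Lemma cp_norm_le_dual (B : R) : 0 <= B ->
  (forall s, (sp_norm E p s <= 1)%E -> nrm (l s) <= B) ->
  (cp_norm E p (fun r => (l (unit_seq r))^*%C) <= B%:E)%E.
Proof.
move=> B0 lB; apply/cp_norm_le => // U oU Uoo F FU.
set t := fun r => (l (unit_seq r))^*%C.
set T := \sum_(r <- F) nrm (t r) ^+ 2.
have q0 : 0 < 2 / p - 1.
  by rewrite subr_gt0 ltr_pdivlMr// mul1r (le_lt_trans p1)// ltr1n.
have mU := open_measurableH oU.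
have T0 : 0 <= T by apply: sumr_ge0 => r _; exact: sqr_ge0.
move: T0; rewrite le_eqVlt => /predU1P[<-|T0].
  by rewrite mulr_ge0 ?sqr_ge0 ?powR_ge0.
have V0 : 0 < fine (mu U).
  have [F0|[r rF]] := fset_0Vmem F.
    by move: T0; rewrite /T F0 big_seq_fset0 ltxx.
  rewrite fine_gt0// Uoo andbT.
  have /andP[r0 _] := muE_gt0 r; apply: (lt_le_trans r0).
  by apply: le_measure; rewrite ?in_setE//; exact: FU.
set V := fine (mu U) in V0 *.
(* Hoelder's bound for the norm of [t] restricted to [F]: the root of [T] times [V] to the power
   [1 / p - 1 / 2]. *)
pose sg := Num.sqrt (T * V `^ (2 / p - 1)).
have TV0 : 0 < T * V `^ (2 / p - 1) by rewrite mulr_gt0// powR_gt0.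
have sg0 : 0 < sg by rewrite sqrtr_gt0.
have sg2 : sg ^+ 2 = T * V `^ (2 / p - 1) by rewrite sqr_sqrtr// ltW.
pose s r := ((sg^-1)%:C%C * t r : C).
have nc : nrm ((sg^-1)%:C%C) = sg^-1.
  by rewrite /= expr0n/= addr0 sqrtr_sqr ger0_norm// invr_ge0 ltW.
have Fs r : r \notin F -> combination F s r = 0 by exact: combination_notin.
have Tsum : \sum_(r <- F) nrm (combination F s r) ^+ 2 = V `^ (- (2 / p)) * V.
  transitivity (\sum_(r <- F) sg^-1 ^+ 2 * nrm (t r) ^+ 2).
    rewrite big_seq [RHS]big_seq; apply: eq_bigr => r rF.
    by rewrite combination_fset rF /s Normc.normcM nc exprMn.
  rewrite -mulr_sumr -/T exprVn sg2 invfM mulrAC mulVf ?gt_eqF// mul1r -powRN.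
  by rewrite powR_mulr//; congr (_ `^ _); ring.
have s1 : (sp_norm E p (combination F s) <= 1)%E.
  apply/(sp_norm_le E p0 _ ler01); rewrite powR1 (sp_mass_finiteE Fs).
  (* The tangent point is the mean of the square sum over [U]; there the bound becomes
     [p / 2 + (1 - p / 2) = 1]. *)
  have c0 : 0 < V `^ (- (2 / p)) by rewrite powR_gt0.
  have := @integral_square_sum_powR_le F (fun r => nrm (combination F s r)) U _ mU Uoo FU c0.
  move=> h; apply: (le_trans h); rewrite Tsum -/V lee_fin.
  set c := V `^ (- (2 / p)) in c0 *.
  have cV : c `^ (p / 2) * V = 1.
    rewrite /c -powRrM (_ : - (2 / p) * (p / 2) = -1); last by field; rewrite gt_eqF.
    by rewrite powR_inv1 ?(ltW V0)// mulVf// gt_eqF.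
  have -> : p / 2 * c `^ (p / 2 - 1) * (c * V) = p / 2.
    rewrite -mulrA [c `^ _ * _]mulrA (_ : c `^ (p / 2 - 1) * c = c `^ (p / 2)).
      by rewrite cV mulr1.
    by rewrite powR_mulr// subrK.
  by rewrite -mulrA cV; lra.
have := lB _ s1; rewrite dual_combination.
(* The conjugate in [t] makes every term a nonnegative real. *)
have -> : \sum_(r <- F) s r * l (unit_seq r) = ((T / sg)%:C)%C.
  rewrite /T mulr_suml rmorph_sum/=; apply: eq_bigr => r _.
  rewrite /s /t; case: (l (unit_seq r)) => u v /=.
  rewrite sqr_sqrtr ?addr_ge0 ?sqr_ge0// sqrrN.
  by apply/eqP; rewrite eq_complex/=; apply/andP; split; apply/eqP; ring.
rewrite /= expr0n/= addr0 sqrtr_sqr ger0_norm ?divr_ge0 ?(ltW T0) ?(ltW sg0)//.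
rewrite ler_pdivrMr// => TB.
have : T ^+ 2 <= (B * sg) ^+ 2.
  by rewrite ler_pXn2r// ?nnegrE ?(ltW T0)// mulr_ge0// ltW.
by rewrite exprMn sg2 expr2 mulrCA ler_pM2l.
Qed.

(** Continuity at 0 provides a radius [d], and scaling by [d / 2] moves the unit ball strictly
    inside it. *)
Lemma dual_bounded : exists2 B : R, 0 <= B &
  forall s, (sp_norm E p s <= 1)%E -> nrm (l s) <= B.
Proof.
have [_ /(_ 0 sp0 1 ltr01)[d d0 dP]] := dl.
have d20 : 0 < d / 2 by rewrite divr_gt0.
exists (d / 2)^-1; first by rewrite invr_ge0 ltW.
move=> s s1; have ss : sp E p s by exact: le_lt_trans s1 (ltry _).
pose c := ((d / 2)%:C%C : C).
have nc : nrm c = d / 2.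
  by rewrite /= expr0n/= addr0 sqrtr_sqr ger0_norm// ltW.
have cs : (sp_norm E p (c *: s + 0 - 0)%R <= (d / 2)%:E)%E.
  apply/(sp_norm_le E p0 _ (ltW d20)).
  rewrite (_ : c *: s + 0 - 0 = (fun r => c * s r)); last first.
    by rewrite subr0 addr0.
  rewrite sp_mass_scale// nc -[leRHS]mule1 lee_wpmul2l ?lee_fin ?powR_ge0//.
  have := (sp_norm_le E p0 s ler01).1 s1.
  by rewrite powR1.
have ss' : sp E p (c *: s + 0).
  by move: cs; rewrite subr0 => /le_lt_trans; apply; exact: ltry.
have := dP _ ss' (le_lt_trans cs _); rewrite lte_fin ltr_pdivrMr// ltr_pMr//.
rewrite ltr1n => /(_ isT); rewrite dual_linear//; last exact: sp0.
rewrite dual0 addr0 subr0 Normc.normcM nc => /ltW.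
by rewrite -ler_pdivlMl// mulr1.
Qed.

(** The coefficients are the conjugated values on unit sequences. The functional and the pairing
    agree on finite combinations, and a single large [F] makes both errors less than [e / 2]. *)
Lemma dual_representation : exists2 t, cp E p t &
  forall s, sp E p s -> l s = pairing s t.
Proof.
have [B B0 lB] := dual_bounded.
pose t r := (l (unit_seq r))^*%C.
have ct : cp E p t by exact: le_lt_trans (cp_norm_le_dual B0 lB) (ltry _).
exists t => // s ss; apply/eqP; rewrite -subr_eq0; apply/eqP/Normc.eq0_normc.
apply/eqP; rewrite eq_le normc_ge0 andbT; apply/ler_addgt0Pr => e e0.
rewrite add0r; have e20 : 0 < e / 2 by rewrite divr_gt0.
have [F0 F0P] := (totally_cvgP _ _).1 (pairing_cvg ss ct) _ e20.
have [_ /(_ s ss _ e20)[d d0 dP]] := dl.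
have [F F0F Fd] := sp_combination_dense F0 ss d0.
have h1 := F0P F F0F; rewrite partial_sumE in h1.
have h2 := dP _ (sp_combination F s) Fd; rewrite dual_combination in h2.
rewrite (_ : l s - pairing s t = - (\sum_(r <- F) s r * l (unit_seq r) - l s) -
    (pairing s t - \sum_(r <- F) pairing_term s t r)).
  apply: (le_trans (le_normcD _ _)); rewrite !normcN (splitr e).
  by rewrite lerD ?ltW.
rewrite (eq_bigr (fun r => pairing_term s t r)) => [|r _].
  by rewrite opprB opprB addrA subrK.
by congr (_ * _); exact/esym/conjcK.
Qed.

End functional.

(** The coefficients of the functional [pairing _ t] are [t] itself, so [cp_norm_le_dual] applies
    with the dual norm as the bound, and no constant is lost. *)
Lemma cp_norm_le_sp_dual_norm t : cp E p t ->
  (cp_norm E p t <= sp_dual_norm E p (fun s => pairing s t))%E.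
Proof.
move=> ct; set l := fun s => _.
have lt r : (l (unit_seq r))^*%C = t r.
  rewrite /l (_ : pairing _ _ = (t r)^*%C) ?conjcK//.
  (* The partial sums are constant as soon as the finite set contains [r]. *)
  apply: sum_cvgP; apply/totally_cvgP => e e0; exists [fset r]%fset => F rF.
  rewrite partial_sumE (bigD1_seq r)//=; last by rewrite -fsub1set.
  rewrite big1 ?addr0 => [|q /negbTE qr]; last by rewrite /pairing_term /unit_seq qr mul0r.
  by rewrite /pairing_term /unit_seq eqxx mul1r subrr Normc.normc0.
have D0 : (0 <= sp_dual_norm E p l)%E.
  apply: ereal_sup_ubound; exists 0.
    rewrite /=; apply/(sp_norm_le E p0 _ ler01).
    rewrite (@sp_mass_finiteE fset0)// powR1.
    under eq_integral do rewrite /square_sum big_seq_fset0 powR0 ?gt_eqF ?divr_gt0//.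
    by rewrite integral0 lee_fin.
  rewrite /l (dual0 (pairing_sp_dual ct)) Normc.normc0//.
have [->|Doo] := eqVneq (sp_dual_norm E p l) +oo%E; first exact: leey.
have fD : sp_dual_norm E p l \is a fin_num by rewrite ge0_fin_numE// ltey.
rewrite -(fineK fD) (_ : t = fun r => (l (unit_seq r))^*%C); last first.
  by apply/funext => r; rewrite lt.
apply: cp_norm_le_dual; [exact: pairing_sp_dual|exact: fine_ge0|].
move=> s s1; rewrite -lee_fin fineK//.
by apply: ereal_sup_ubound; exists s.
Qed.

End sequence_duality.

(** * Duality of s^p and c^p for vertical dyadic rectangles *)

Unset Implicit Arguments. Set Strict Implicit. Set Printing Implicit Defensive.

Theorem theorem8 (R : realType) (n m N : nat) (kappa p : R)
    (S : int -> 'rV[int]_n * 'rV[int]_n -> int -> set (heis R n)) :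
  (0 < n)%N -> (0 < m)%N -> 0 < kappa -> dyadic_cubes m S ->
  0 < p -> p <= 1 ->
  let E := rect_set m S kappa N in
  (exists C1 C2 : R, [/\ 0 < C1, 0 < C2 &
    forall t : rect_index m S kappa N -> R[i], cp E p t ->
      [/\ forall s, sp E p s ->
            cvg (partial_sum (pairing_term s t) @ totally),
          sp_dual E p (fun s => pairing s t) &
          (C1%:E * cp_norm E p t <= sp_dual_norm E p (fun s => pairing s t)
             <= C2%:E * cp_norm E p t)%E]]) /\
  (forall l : (rect_index m S kappa N -> R[i]) -> R[i], sp_dual E p l ->
     exists2 t, cp E p t & forall s, sp E p s -> l s = pairing s t).
Proof.
move=> n0 m0 kappa0 DS p0 p1 E.
have cI := @countable_rect_index R n m N kappa S.
have mE : forall r, measurable (E r) by exact: measurable_rect_set.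
have muE : forall r, (0 < heis_measure (E r) < +oo)%E by exact: rect_set_measure.
have openm := @open_heis_measurable R n.
have [K K0 cover] := rect_strong_cover N n0 m0 kappa0 DS.
split; last by move=> l; exact: (dual_representation p0 p1 cI mE muE openm K0 cover).
(* The lower constant is exactly 1; the upper one depends only on [p] and the covering constant
   [K]. *)
exists 1, (duality_const K p + 1); split => //.
  by rewrite ltr_wpDl// duality_const_ge0.
move=> t ct; split.
- by move=> s ss; exact: (pairing_cvg p0 p1 cI mE muE openm K0 cover).
- exact: (pairing_sp_dual p0 p1 cI mE muE openm K0 cover).
- apply/andP; split.
    by rewrite mul1e; exact: (cp_norm_le_sp_dual_norm p0 p1 cI mE muE openm K0 cover).
  exact: (sp_dual_norm_pairing_le p0 p1 cI mE muE openm K0 cover).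
Qed.
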